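(* Let $s$ and $t$ be relatively prime positive integers, and let $X$ denote the size of a partition chosen uniformly at random from the set of $(s,t)$-core partitions. Then the sixth moment of $X$ about its mean is $$\mathbf{E}\big[(X-\mathbf{E}[X])^6\big]=\frac{1}{4184557977600}\, s\,t\,(t-1)(s-1)(s+t+1)(s+t)\,P(s,t),$$ where $$\begin{aligned}P(s,t)={}&307561s^8t^4+1230244s^7t^5+1845366s^6t^6+1230244s^5t^7+307561s^4t^8\\&-2056306s^8t^3-8225224s^7t^4-14394142s^6t^5-14394142s^5t^6-8225224s^4t^7-2056306s^3t^8\\&+5372061s^8t^2+21488244s^7t^3+42976488s^6t^4+53720610s^5t^5+42976488s^4t^6+21488244s^3t^7+5372061s^2t^8\\&-6453396s^8t-25813584s^7t^2-60704054s^6t^3-91764618s^5t^4-91764618s^4t^5-60704054s^3t^6-25813584s^2t^7-6453396st^8\\&+2985120s^8+11940480s^7t+39743142s^6t^2+77437746s^5t^3+96285048s^4t^4+77437746s^3t^5+39743142s^2t^6+11940480st^7+2985120t^8\\&-11104272s^6t-33312816s^5t^2-55521360s^4t^3-55521360s^3t^4-33312816s^2t^5-11104272st^6\\&+2985120s^6+8955360s^5t+23840061s^4t^2+32754522s^3t^3+23840061s^2t^4+8955360st^5+2985120t^6\\&-9109476s^4t-18218952s^3t^2-18218952s^2t^3-9109476st^4\\&+2985120s^4+5970240s^3t+8955360s^2t^2+5970240st^3+2985120t^4\\&+8664840s^2t+8664840st^2-62687520s^2-62687520st-62687520t^2+626875200.\end{aligned}$$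
   Context: A partition is a non-increasing finite sequence of positive integers $\lambda=(\lambda_1,\dots,\lambda_k)$, $k\ge 0$ (the empty partition is allowed); its size is $\lambda_1+\dots+\lambda_k$. Its Ferrers diagram consists of the cells $(i,j)$ with $1\le i\le k$, $1\le j\le\lambda_i$. The hook length of cell $(i,j)$ is $\lambda_i-j+\lambda'_j-i+1$, where $\lambda'$ is the conjugate partition ($\lambda'_j$ = number of $i$ with $\lambda_i\ge j$). A partition is an $s$-core if no cell has hook length equal to $s$, and an $(s,t)$-core partition if it is simultaneously an $s$-core and a $t$-core. For coprime $s,t$ the set of $(s,t)$-core partitions is finite, and it is given the uniform probability distribution. *)

(* Defs.v *)
From mathcomp Require Import all_boot all_order all_algebra.
From mathcomp Require Import finmap.
From mathcomp Require Import boolp classical_sets cardinality.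

Set Implicit Arguments.
Unset Strict Implicit.
Unset Printing Implicit Defensive.

Import GRing.Theory.

Local Open Scope nat_scope.

Definition is_part (la : seq nat) : bool :=
  sorted geq la && all (fun x => 0 < x) la.

(* Rows, columns and cells are numbered from 1. *)
Definition row_len (la : seq nat) (i : nat) : nat := nth 0 la i.-1.

Definition col_len (la : seq nat) (j : nat) : nat :=
  count (fun x => j <= x) la.

Definition in_ferrers (la : seq nat) (i j : nat) : bool :=
  (1 <= i <= size la) && (1 <= j <= row_len la i).

(* For a cell of the Ferrers diagram of a partition, j <= row_len la i and
   i <= col_len la j, so neither subtraction is truncated. *)
Definition hook_length (la : seq nat) (i j : nat) : nat :=
  (row_len la i - j) + (col_len la j - i) + 1.

Definition is_core (s : nat) (la : seq nat) : Prop :=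
  forall i j, in_ferrers la i j -> hook_length la i j <> s.

Local Open Scope classical_set_scope.

Definition st_cores (s t : nat) : set (seq nat) :=
  [set la | [/\ is_part la, is_core s la & is_core t la]].

Local Open Scope ring_scope.

(* Expectation under the uniform distribution on A, for A finite and nonempty
   (fset_set A has the same elements as A when A is finite). *)
Definition unif_expect (T : choiceType) (A : set T) (X : T -> rat) : rat :=
  (\sum_(x <- fset_set A) X x) / (#|` fset_set A |)%:R.

Definition central_moment (T : choiceType) (A : set T) (k : nat)
    (X : T -> rat) : rat :=
  unif_expect A (fun x => (X x - unif_expect A X) ^+ k).

Definition part_size (la : seq nat) : rat := (sumn la)%:R.

(* The coefficients are written n%:R because a bare ring_scope numeral of this
   magnitude is expanded in unary. *)
Definition P6 (s t : rat) : rat :=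
  307561%:R * s ^+ 8 * t ^+ 4 + 1230244%:R * s ^+ 7 * t ^+ 5
    + 1845366%:R * s ^+ 6 * t ^+ 6 + 1230244%:R * s ^+ 5 * t ^+ 7
    + 307561%:R * s ^+ 4 * t ^+ 8
  - 2056306%:R * s ^+ 8 * t ^+ 3 - 8225224%:R * s ^+ 7 * t ^+ 4
    - 14394142%:R * s ^+ 6 * t ^+ 5 - 14394142%:R * s ^+ 5 * t ^+ 6
    - 8225224%:R * s ^+ 4 * t ^+ 7 - 2056306%:R * s ^+ 3 * t ^+ 8
  + 5372061%:R * s ^+ 8 * t ^+ 2 + 21488244%:R * s ^+ 7 * t ^+ 3
    + 42976488%:R * s ^+ 6 * t ^+ 4 + 53720610%:R * s ^+ 5 * t ^+ 5
    + 42976488%:R * s ^+ 4 * t ^+ 6 + 21488244%:R * s ^+ 3 * t ^+ 7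
    + 5372061%:R * s ^+ 2 * t ^+ 8
  - 6453396%:R * s ^+ 8 * t - 25813584%:R * s ^+ 7 * t ^+ 2
    - 60704054%:R * s ^+ 6 * t ^+ 3 - 91764618%:R * s ^+ 5 * t ^+ 4
    - 91764618%:R * s ^+ 4 * t ^+ 5 - 60704054%:R * s ^+ 3 * t ^+ 6
    - 25813584%:R * s ^+ 2 * t ^+ 7 - 6453396%:R * s * t ^+ 8
  + 2985120%:R * s ^+ 8 + 11940480%:R * s ^+ 7 * t
    + 39743142%:R * s ^+ 6 * t ^+ 2 + 77437746%:R * s ^+ 5 * t ^+ 3
    + 96285048%:R * s ^+ 4 * t ^+ 4 + 77437746%:R * s ^+ 3 * t ^+ 5
    + 39743142%:R * s ^+ 2 * t ^+ 6 + 11940480%:R * s * t ^+ 7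
    + 2985120%:R * t ^+ 8
  - 11104272%:R * s ^+ 6 * t - 33312816%:R * s ^+ 5 * t ^+ 2
    - 55521360%:R * s ^+ 4 * t ^+ 3 - 55521360%:R * s ^+ 3 * t ^+ 4
    - 33312816%:R * s ^+ 2 * t ^+ 5 - 11104272%:R * s * t ^+ 6
  + 2985120%:R * s ^+ 6 + 8955360%:R * s ^+ 5 * t
    + 23840061%:R * s ^+ 4 * t ^+ 2 + 32754522%:R * s ^+ 3 * t ^+ 3
    + 23840061%:R * s ^+ 2 * t ^+ 4 + 8955360%:R * s * t ^+ 5
    + 2985120%:R * t ^+ 6
  - 9109476%:R * s ^+ 4 * t - 18218952%:R * s ^+ 3 * t ^+ 2
    - 18218952%:R * s ^+ 2 * t ^+ 3 - 9109476%:R * s * t ^+ 4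
  + 2985120%:R * s ^+ 4 + 5970240%:R * s ^+ 3 * t
    + 8955360%:R * s ^+ 2 * t ^+ 2 + 5970240%:R * s * t ^+ 3
    + 2985120%:R * t ^+ 4
  + 8664840%:R * s ^+ 2 * t + 8664840%:R * s * t ^+ 2 - 62687520%:R * s ^+ 2
    - 62687520%:R * s * t - 62687520%:R * t ^+ 2 + 626875200%:R.

(* Main.v *)
From Stdlib Require Import ZArith.
Require Import Defs.
From mathcomp Require Import all_boot all_order all_algebra.
From mathcomp Require Import finmap.
From mathcomp Require Import boolp classical_sets cardinality.
From mathcomp Require Import zify ssrZ common ring.

Set Implicit Arguments.
Unset Strict Implicit.
Unset Printing Implicit Defensive.

Import Order.TTheory GRing.Theory Num.Theory.

Local Open Scope ring_scope.
(* [%Z] already delimits the scope of [int]. *)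
Local Delimit Scope Z_scope with zz.

(** Put [n = s + t]. The complement [D] of the beta-set of an [(s, t)]-core is
    closed under adding [s] and [t]; the elements [z] of [D] with [z - n] not in
    [D] form one cycle under [z -> z - s] (if this is in [D]) or [z -> z + t],
    starting at [0]. Recording the steps gives a word with [s] letters [+ t] and
    [t] letters [- s] whose partial sums are nonnegative, and this is a
    bijection. The size of the core is [Var(z) / 2 - (n^2 - 1) / 24], where
    [Var] is the variance of the [n] partial sums. This is invariant under
    rotation of the word, and by the cycle lemma each word has exactly one
    nonnegative rotation, so the size may be averaged over all [C(n, s)] words.

    For words with [x] ones and [y] zeros, the mean of a product of path sums of
    polynomials is a polynomial in [x] and [y]: the recursion on the last letter
    is diagonal on products of falling factorials. The size has degree [4] in
    this sense, so its sixth central moment is a polynomial of degree at most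
    [24]. It agrees with the stated one for all [x + y <= 24], by a computation
    of joint moments of the path sums of [x], [x^2] and [x (x + y)], hence
    everywhere. *)
(** * Polynomial functions of two natural numbers *)

Definition falling2 (i j x y : nat) : rat := (x ^_ i)%:R * (y ^_ j)%:R.

(** Polynomials of total degree at most [d], as finite sums in the basis of falling factorials, in
    which differences and the recursion on the last letter of a word act term by term. *)
Inductive polyd (d : nat) : (nat -> nat -> rat) -> Prop :=
| Polyd0 f : (forall x y, f x y = 0) -> polyd d f
| PolydS f g c i j : (i + j <= d)%N -> polyd d g ->
    (forall x y, f x y = c * falling2 i j x y + g x y) -> polyd d f.

Lemma polyd_ext d f g : (forall x y, f x y = g x y) -> polyd d f -> polyd d g.
Proof.
move=> fg pf; case: pf fg => [{}f f0|{}f h c i j le_d ph fE] fg.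
  by apply: Polyd0 => x y; rewrite -fg f0.
by apply: PolydS le_d ph _ => x y; rewrite -fg fE.
Qed.

Lemma polyd_add d f g :
  polyd d f -> polyd d g -> polyd d (fun x y => f x y + g x y).
Proof.
move=> pf pg; elim: pf => [{}f f0|{}f h c i j le_d _ IH fE].
  by apply: polyd_ext pg => x y; rewrite f0 add0r.
by apply: PolydS le_d IH _ => x y; rewrite fE addrA.
Qed.

Lemma polyd_scale d a f : polyd d f -> polyd d (fun x y => a * f x y).
Proof.
elim=> [{}f f0|{}f h c i j le_d _ IH fE].
  by apply: Polyd0 => x y; rewrite f0 mulr0.
by apply: (PolydS (c := a * c) le_d IH) => x y; rewrite fE mulrDr mulrA.
Qed.

Lemma polyd_opp d f : polyd d f -> polyd d (fun x y => - f x y).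
Proof. by move/(polyd_scale (-1)); apply: polyd_ext => x y; rewrite mulN1r. Qed.

Lemma polyd_sub d f g :
  polyd d f -> polyd d g -> polyd d (fun x y => f x y - g x y).
Proof. by move=> pf /polyd_opp; apply: polyd_add. Qed.

Lemma polyd_le d e f : (d <= e)%N -> polyd d f -> polyd e f.
Proof.
move=> le_de; elim=> [{}f f0|{}f h c i j le_d _ IH fE]; first exact: Polyd0.
exact: PolydS (leq_trans le_d le_de) IH fE.
Qed.

Lemma polyd_falling2 d i j : (i + j <= d)%N -> polyd d (falling2 i j).
Proof.
move=> le_d; apply: (@PolydS _ _ (fun _ _ => 0) 1 i j) => //.
  exact: Polyd0.
by move=> x y; rewrite mul1r addr0.
Qed.

Lemma polyd_const d c : polyd d (fun _ _ => c).
Proof.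
apply: (@PolydS _ _ (fun _ _ => 0) c 0 0) => //; first exact: Polyd0.
by move=> x y; rewrite /falling2 !ffactn0 !mulr1 addr0.
Qed.

Lemma ffact_succ (x i : nat) :
  (x ^_ i.+1)%:R = (x%:R - i%:R) * (x ^_ i)%:R :> rat.
Proof.
rewrite ffactnSr; case: (leqP i x) => [le_ix|lt_xi].
  by rewrite natrM natrB // mulrC.
by rewrite ffact_small // mul0n mulr0.
Qed.

Lemma ffact_pred (x i : nat) :
  x%:R * (x.-1 ^_ i)%:R = (x%:R - i%:R) * (x ^_ i)%:R :> rat.
Proof. by rewrite -ffact_succ ffactnS natrM. Qed.

Lemma polyd_mulx d f : polyd d f -> polyd d.+1 (fun x y => x%:R * f x y).
Proof.
elim=> [{}f f0|{}f h c i j le_d _ IH fE].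
  by apply: Polyd0 => x y; rewrite f0 mulr0.
apply: (polyd_ext (f := fun x y => c * (falling2 i.+1 j x y
    + i%:R * falling2 i j x y) + x%:R * h x y)).
  by move=> x y; rewrite fE /falling2 ffact_succ; ring.
apply: polyd_add IH; apply: polyd_scale; apply: polyd_add.
  by apply: polyd_falling2; rewrite addSn ltnS.
by apply: polyd_scale; apply: polyd_falling2; apply: leqW.
Qed.

Lemma polyd_muly d f : polyd d f -> polyd d.+1 (fun x y => y%:R * f x y).
Proof.
elim=> [{}f f0|{}f h c i j le_d _ IH fE].
  by apply: Polyd0 => x y; rewrite f0 mulr0.
apply: (polyd_ext (f := fun x y => c * (falling2 i j.+1 x y
    + j%:R * falling2 i j x y) + y%:R * h x y)).
  by move=> x y; rewrite fE /falling2 ffact_succ; ring.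
apply: polyd_add IH; apply: polyd_scale; apply: polyd_add.
  by apply: polyd_falling2; rewrite addnS ltnS.
by apply: polyd_scale; apply: polyd_falling2; apply: leqW.
Qed.

Lemma polyd_mul_falling2 d i j f :
  polyd d f -> polyd (i + j + d) (fun x y => falling2 i j x y * f x y).
Proof.
move=> pf; elim: i => [|i IHi].
  elim: j => [|j IHj].
    by apply: polyd_ext pf => x y; rewrite /falling2 !ffactn0 !mul1r.
  apply: polyd_ext (polyd_sub (polyd_muly IHj)
    (polyd_scale j%:R (polyd_le (leqnSn _) IHj))) => x y.
  by rewrite /falling2 ffact_succ; ring.
apply: polyd_ext (polyd_sub (polyd_mulx IHi)
  (polyd_scale i%:R (polyd_le (leqnSn _) IHi))) => x y.
by rewrite /falling2 ffact_succ; ring.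
Qed.

Lemma polyd_mul d e f g :
  polyd d f -> polyd e g -> polyd (d + e) (fun x y => f x y * g x y).
Proof.
move=> pf pg; elim: pf => [{}f f0|{}f h c i j le_d _ IH fE].
  by apply: Polyd0 => x y; rewrite f0 mul0r.
apply: polyd_ext (polyd_add (polyd_scale c
  (polyd_le _ (polyd_mul_falling2 i j pg))) IH) => [x y|].
  by rewrite fE; ring.
by rewrite leq_add2r.
Qed.

Lemma polyd_exp d k f : polyd d f -> polyd (k * d) (fun x y => f x y ^+ k).
Proof.
move=> pf; elim: k => [|k IH].
  by apply: polyd_ext (polyd_const 0 1) => x y; rewrite expr0.
by apply: polyd_ext (polyd_mul pf IH) => x y; rewrite exprS.
Qed.

Lemma polydX : polyd 1 (fun x _ => x%:R).
Proof. by apply: polyd_ext (polyd_mulx (polyd_const 0 1)) => x y; rewrite mulr1. Qed.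

Lemma polydY : polyd 1 (fun _ y => y%:R).
Proof. by apply: polyd_ext (polyd_muly (polyd_const 0 1)) => x y; rewrite mulr1. Qed.

Lemma ffact_diff (x i : nat) :
  (x.+1 ^_ i)%:R - (x ^_ i)%:R = i%:R * (x ^_ i.-1)%:R :> rat.
Proof.
case: i => [|i]; first by rewrite !ffactn0 mul0r subrr.
rewrite (ffact_succ x) ffactSS natrM /= -(natr1 i) -(natr1 x); ring.
Qed.

Lemma polyd_diffx d f :
  polyd d.+1 f -> polyd d (fun x y => f x.+1 y - f x y).
Proof.
elim=> [{}f f0|{}f h c i j le_d _ IH fE].
  by apply: Polyd0 => x y; rewrite !f0 subrr.
apply: polyd_ext (_ : polyd d (fun x y => c * (i%:R * falling2 i.-1 j x y)
   + (h x.+1 y - h x y))) => [x y|].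
  by rewrite !fE /falling2 (mulrA i%:R) -ffact_diff; ring.
apply: polyd_add IH; apply: polyd_scale; case: i le_d {fE} => [|i] le_d.
  by apply: Polyd0 => x y; rewrite mul0r.
by apply: polyd_scale; apply: polyd_falling2.
Qed.

Lemma polyd_diffy d f :
  polyd d.+1 f -> polyd d (fun x y => f x y.+1 - f x y).
Proof.
elim=> [{}f f0|{}f h c i j le_d _ IH fE].
  by apply: Polyd0 => x y; rewrite !f0 subrr.
apply: polyd_ext (_ : polyd d (fun x y => c * (j%:R * falling2 i j.-1 x y)
   + (h x y.+1 - h x y))) => [x y|].
  by rewrite !fE /falling2 (mulrCA j%:R) -ffact_diff; ring.
apply: polyd_add IH; apply: polyd_scale; case: j le_d {fE} => [|j] le_d.
  by apply: Polyd0 => x y; rewrite mul0r.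
by apply: polyd_scale; apply: polyd_falling2; rewrite -ltnS -addnS.
Qed.

Lemma polyd0_const f : polyd 0 f -> forall x y, f x y = f 0%N 0%N.
Proof.
elim=> [{}f f0|{}f h c i j le_d _ IH fE] x y; first by rewrite !f0.
have [/eqP i0 /eqP j0] : i == 0%N /\ j == 0%N by split; lia.
by rewrite !fE IH i0 j0 /falling2 !ffactn0.
Qed.

(** Interpolation on a triangle: both first differences have lower degree and vanish on the smaller
    triangle, hence everywhere by induction, so [f] is constant and equals its value at the
    origin. *)
Lemma polyd_eq0 d f : polyd d f ->
  (forall x y, (x + y <= d)%N -> f x y = 0) -> forall x y, f x y = 0.
Proof.
elim: d f => [|d IH] f pf f0.
  by move=> x y; rewrite (polyd0_const pf) f0.
have fx x y : f x.+1 y = f x y.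
  apply/eqP; rewrite -subr_eq0; apply/eqP.
  apply: (IH _ (polyd_diffx pf)) => {}x {}y le_d.
  by rewrite !f0 ?subrr //; lia.
have fy x y : f x y.+1 = f x y.
  apply/eqP; rewrite -subr_eq0; apply/eqP.
  apply: (IH _ (polyd_diffy pf)) => {}x {}y le_d.
  by rewrite !f0 ?subrr //; lia.
elim=> [|x IHx] y; last by rewrite fx.
by elim: y => [|y IHy]; [rewrite f0 | rewrite fy].
Qed.

(* [falling2 i j] is an eigenvector, for the eigenvalue [i + j], of
   [q |-> (x + y) q(x, y) - x q(x - 1, y) - y q(x, y - 1)]. *)
Lemma polyd_path_solve d r : polyd d r ->
  exists q, [/\ polyd d.+1 q, q 0%N 0%N = 0 & forall x y,
    (x + y)%:R * q x y = x%:R * (q x.-1 y + r x.-1 y)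
                         + y%:R * (q x y.-1 + r x y.-1)].
Proof.
elim=> [{}r r0|{}r h c i j le_d _ [q [pq q0 qE]] rE].
  exists (fun _ _ => 0); split=> //; first exact: Polyd0.
  by move=> x y; rewrite !r0 !addr0 !mulr0 addr0.
(* The source term [c * falling2 i j] contributes [c] times the sum of [falling2 i.+1 j] and
   [falling2 i j.+1]. Both have eigenvalue [i + j + 1], so dividing by it solves the equation. *)
pose a : rat := c / (i + j).+1%:R.
exists (fun x y => a * (falling2 i.+1 j x y + falling2 i j.+1 x y) + q x y).
split.
- apply: polyd_add pq; apply: polyd_scale.
  by apply: polyd_add; apply: polyd_falling2; rewrite ?addSn ?addnS ltnS.
- by rewrite /falling2 !ffact0n /= !mulr0 mul0r addr0 mulr0 add0r.
move=> x y; rewrite mulrDr qE !rE.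
have xE k : x%:R * falling2 k j x.-1 y = (x%:R - k%:R) * falling2 k j x y.
  by rewrite /falling2 mulrA ffact_pred mulrA.
have yE k : y%:R * falling2 i k x y.-1 = (y%:R - k%:R) * falling2 i k x y.
  by rewrite /falling2 mulrCA ffact_pred; ring.
have xE' : x%:R * falling2 i j.+1 x.-1 y = (x%:R - i%:R) * falling2 i j.+1 x y.
  by rewrite /falling2 mulrA ffact_pred mulrA.
have yE' : y%:R * falling2 i.+1 j x y.-1 = (y%:R - j%:R) * falling2 i.+1 j x y.
  by rewrite /falling2 mulrCA ffact_pred; ring.
have fx : falling2 i.+1 j x y = (x%:R - i%:R) * falling2 i j x y.
  by rewrite /falling2 ffact_succ mulrA.
have fy : falling2 i j.+1 x y = (y%:R - j%:R) * falling2 i j x y.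
  by rewrite /falling2 ffact_succ; ring.
have aE : c = a * (i%:R + j%:R + 1) by rewrite /a -natrD natr1 divfK // pnatr_eq0.
transitivity (a * (x%:R * falling2 i.+1 j x.-1 y + x%:R * falling2 i j.+1 x.-1 y
   + y%:R * falling2 i.+1 j x y.-1 + y%:R * falling2 i j.+1 x y.-1)
   + c * (x%:R * falling2 i j x.-1 y + y%:R * falling2 i j x y.-1)
   + (x%:R * (q x.-1 y + h x.-1 y) + y%:R * (q x y.-1 + h x y.-1))); last by ring.
by rewrite xE xE' yE' yE !xE !yE fx fy aE natrD -!natr1; ring.
Qed.

(** * Path sums over lattice words *)

Fixpoint words (n x : nat) : seq bitseq :=
  if n is n'.+1 then
    [seq rcons w false | w <- words n' x] ++
    (if x is x'.+1 then [seq rcons w true | w <- words n' x'] else [::])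
  else if x is 0%N then [:: [::]] else [::].

Definition ones (w : bitseq) : nat := count id w.
Definition zeros (w : bitseq) : nat := (size w - ones w)%N.

Lemma ones_le w : (ones w <= size w)%N.
Proof. exact: count_size. Qed.

Lemma ones_rcons w b : ones (rcons w b) = (ones w + b)%N.
Proof. by rewrite /ones -cats1 count_cat /= addn0. Qed.

Lemma mem_words n x w :
  (w \in words n x) = (size w == n) && (ones w == x).
Proof.
elim: n x w => [|n IH] x w /=.
  by case: x => [|x]; case: w => [|b w].
case/lastP: w => [|w b].
  rewrite mem_cat; apply/negbTE; rewrite negb_or; apply/andP; split.
    by apply/mapP => -[w _ /(congr1 size)]; rewrite size_rcons.
  by case: x => // x; apply/mapP => -[w _ /(congr1 size)]; rewrite size_rcons.
rewrite mem_cat size_rcons eqSS ones_rcons.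
have in_map c y : (rcons w b \in [seq rcons v c | v <- words n y])
    = (c == b) && (w \in words n y).
  apply/mapP/andP => [[v wv /rcons_inj [-> ->]]|[/eqP <- wv]] //.
  by exists w.
rewrite in_map IH; case: x => [|x]; last rewrite in_map IH.
  by case: b {in_map}; rewrite ?addn0 ?addn1 ?orbF //= andbF.
by case: b {in_map}; rewrite /= ?addn0 ?addn1 ?orbF ?eqSS.
Qed.

Lemma words_uniq n x : uniq (words n x).
Proof.
have uniq_map c s : uniq s -> uniq [seq rcons w c | w : bitseq <- s].
  by rewrite map_inj_uniq // => w v /rcons_inj [].
elim: n x => [|n IH] x /=; first by case: x.
rewrite cat_uniq uniq_map //=; case: x => // x; rewrite uniq_map // andbT.
apply/hasPn => _ /mapP [w _ ->]; apply/mapP => -[v _].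
by case/rcons_inj.
Qed.

Lemma size_words n x : size (words n x) = 'C(n, x).
Proof.
elim: n x => [|n IH] x /=; first by case: x.
by rewrite size_cat size_map IH; case: x => [|x]; rewrite ?bin0 ?size_map ?IH.
Qed.

Lemma words_zeros x y w : w \in words (x + y) x -> ones w = x /\ zeros w = y.
Proof. by rewrite mem_words /zeros => /andP [/eqP -> /eqP ->]; rewrite addKn. Qed.

Definition wsum (F : bitseq -> rat) (x y : nat) : rat :=
  \sum_(w <- words (x + y) x) F w.

Lemma wsum_add F G x y :
  wsum (fun w => F w + G w) x y = wsum F x y + wsum G x y.
Proof. exact: big_split. Qed.

(** The indicators remove the case of a last letter that the word cannot have, where the truncated
    predecessor would give a nonempty sum. *)
Lemma wsum_rec F G x y : (forall w b, F (rcons w b) = G w) -> (0 < x + y)%N ->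
  (x + y)%:R * wsum F x y =
    (x + y)%:R * ((0 < y)%N%:R * wsum G x y.-1 + (0 < x)%N%:R * wsum G x.-1 y).
Proof.
move=> FG n0; congr (_ * _); rewrite /wsum.
case: y n0 => [|y] n0 /=.
  case: x n0 => // x _; rewrite !addn0 mul0r add0r mul1r /=.
  rewrite big_cat !big_map /= [X in X + _]big1_seq ?add0r.
    by apply: eq_bigr => w _.
  move=> w /andP [_]; rewrite mem_words => /andP [/eqP sw /eqP ow].
  by have := ones_le w; rewrite sw ow ltnn.
rewrite addnS /= big_cat big_map mul1r; congr (_ + _); first exact: eq_bigr.
case: x n0 => [|x] _; first by rewrite big_nil mul0r.
by rewrite big_map mul1r addSnnS; apply: eq_bigr.
Qed.

Definition poly_mean (d : nat) (F : bitseq -> rat) : Prop :=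
  exists2 q, polyd d q & forall x y, wsum F x y = 'C(x + y, x)%:R * q x y.

Lemma poly_mean_ext d F G : F =1 G -> poly_mean d F -> poly_mean d G.
Proof.
by move=> FG [q pq qE]; exists q => // x y; rewrite -qE; apply: eq_bigr => w _.
Qed.

Lemma poly_mean_le d e F : (d <= e)%N -> poly_mean d F -> poly_mean e F.
Proof. by move=> le_de [q pq qE]; exists q => //; apply: polyd_le pq. Qed.

Lemma poly_mean_add d F G :
  poly_mean d F -> poly_mean d G -> poly_mean d (fun w => F w + G w).
Proof.
move=> [q pq qE] [r pr rE]; exists (fun x y => q x y + r x y).
  exact: polyd_add.
by move=> x y; rewrite wsum_add qE rE mulrDr.
Qed.

Lemma poly_mean_mul d e p F : polyd d p -> poly_mean e F ->
  poly_mean (d + e) (fun w => p (ones w) (zeros w) * F w).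
Proof.
move=> pp [q pq qE]; exists (fun x y => p x y * q x y); first exact: polyd_mul.
move=> x y; rewrite mulrCA -qE /wsum mulr_sumr.
by apply: eq_big_seq => w /words_zeros [-> ->].
Qed.

Lemma poly_mean_const d c : poly_mean d (fun _ => c).
Proof.
exists (fun _ _ => c); first exact: polyd_const.
move=> x y; rewrite /wsum big_const_seq count_predT iter_addr addr0.
by rewrite size_words mulr_natl.
Qed.

(** The last letter is a one for a fraction [x / (x + y)] of the words, so the means obey the
    recursion solved by [polyd_path_solve], with the same initial value. *)
Lemma poly_mean_step d F R :
  F [::] = 0 -> (forall w b, F (rcons w b) = F w + R w) ->
  poly_mean d R -> poly_mean d.+1 F.
Proof.
move=> F0 FR [r pr rE]; have [q [pq q0 qE]] := polyd_path_solve pr.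
exists q => // x y; move En: (x + y)%N => n.
elim: n x y En => [|n IH] x y En.
  have [-> ->] : x = 0%N /\ y = 0%N by split; lia.
  by rewrite q0 mulr0 /wsum /= big_seq1.
have n0 : ((x + y)%:R : rat) != 0 by rewrite En pnatr_eq0.
apply: (mulfI n0); rewrite (wsum_rec (G := fun w => F w + R w)) ?En //.
rewrite -En mulrCA qE !wsum_add.
rewrite [LHS]mulrDr [RHS]mulrDr [RHS]addrC; congr (_ + _).
- case: y En {n0} => [|y] En /=; first by rewrite !mul0r !mulr0.
  rewrite mul1r rE IH; last by lia.
  have -> : (x + y)%N = n by lia.
  (* Absorption: [x + y] times the binomial of the shorter words is [y] times that of the full
     words; in the other case it is [x] times. *)
  have /(congr1 (fun k => k%:R : rat)) := mul_bin_down n.+1 x.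
  rewrite !natrM -mulrDr mulrA En /= => ->.
  by rewrite [RHS]mulrA; congr (_ * _); rewrite mulrC; congr (_ * _%:R); lia.
- case: x En {n0} => [|x] En /=; first by rewrite !mul0r !mulr0.
  rewrite mul1r rE IH; last by lia.
  have -> : (x + y)%N = n by lia.
  have /(congr1 (fun k => k%:R : rat)) := mul_bin_diag n.+1 x.
  rewrite !natrM -mulrDr mulrA En /= => ->.
  by rewrite [RHS]mulrA; congr (_ * _); rewrite mulrC.
Qed.

Definition prefix_ones (w : bitseq) (i : nat) : nat := ones (take i w).

(** The endpoint is left out, so appending a letter adds the value of [u] at the old endpoint,
    whichever the letter is. *)
Definition path_sum (u : nat -> nat -> rat) (w : bitseq) : rat :=
  \sum_(i < size w) u (prefix_ones w i) (i - prefix_ones w i)%N.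

Lemma path_sum_nil u : path_sum u [::] = 0.
Proof. by rewrite /path_sum big_ord0. Qed.

Lemma path_sum_rcons u w b :
  path_sum u (rcons w b) = path_sum u w + u (ones w) (zeros w).
Proof.
rewrite /path_sum size_rcons big_ord_recr /=; congr (_ + u _ (_ - _)%N).
- by apply: eq_bigr => i _; rewrite /prefix_ones -cats1 takel_cat // ltnW.
- by rewrite /prefix_ones -cats1 take_size_cat.
- by rewrite /prefix_ones -cats1 take_size_cat.
Qed.

(* A factor [(d, u)] stands for the path sum of [u], a polynomial of degree
   at most [d]. *)
Definition factor : Type := (nat * (nat -> nat -> rat))%type.

Fixpoint path_prod (l : seq factor) (w : bitseq) : rat :=
  if l is (d, u) :: l' then path_sum u w * path_prod l' w else 1.

Fixpoint path_prod_incl (l : seq factor) (w : bitseq) : rat :=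
  if l is (d, u) :: l' then
    (path_sum u w + u (ones w) (zeros w)) * path_prod_incl l' w
  else 1.

Fixpoint weight (l : seq factor) : nat :=
  if l is (d, _) :: l' then (d.+1 + weight l')%N else 0%N.

Fixpoint well_deg (l : seq factor) : Prop :=
  if l is (d, u) :: l' then polyd d u /\ well_deg l' else True.

Lemma path_prod_rcons l w b : path_prod l (rcons w b) = path_prod_incl l w.
Proof. by elim: l => //= -[d u] l ->; rewrite path_sum_rcons. Qed.

Lemma path_prod_cat l1 l2 w :
  path_prod (l1 ++ l2) w = path_prod l1 w * path_prod l2 w.
Proof. by elim: l1 => /= [|[d u] l1 ->]; rewrite ?mul1r ?mulrA. Qed.

Lemma weight_cat l1 l2 : weight (l1 ++ l2) = (weight l1 + weight l2)%N.
Proof. by elim: l1 => //= -[d u] l1 ->; rewrite addnA. Qed.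

Lemma well_deg_cat l1 l2 : well_deg l1 -> well_deg l2 -> well_deg (l1 ++ l2).
Proof. by elim: l1 => //= -[d u] l1 IH [pu wl1] wl2; split=> //; apply: IH. Qed.

(** Appending a letter changes the product by terms in which at least one path sum is replaced by an
    endpoint value. Such a term has fewer path sums, so induction on their number applies; its
    degree is lower by at least one, which [poly_mean_step] gives back. *)
Lemma poly_mean_path_prod l : well_deg l -> poly_mean (weight l) (path_prod l).
Proof.
move: {2}(size l) (leqnn (size l)) => m; elim: m l => [|m IHm] l.
  by case: l => // _ _; apply: poly_mean_const.
(* The list [l1] collects the factors of which the path sum is kept while [l2] is expanded one
   factor at a time. *)
have diff l1 l2 : (size l1 + size l2 <= m.+1)%N -> well_deg l1 -> well_deg l2 ->
    poly_mean (weight l1 + weight l2).-1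
      (fun w => path_prod l1 w * (path_prod_incl l2 w - path_prod l2 w)).
  elim: l2 l1 => [|[d u] l2 IHl] l1 /= le_m wl1.
    by move=> _; apply: poly_mean_ext (poly_mean_const _ 0) => w; rewrite subrr mulr0.
  case=> pu wl2.
  have le_m' : (size l1 + size l2 <= m)%N by rewrite addnS ltnS in le_m.
  pose l1u := rcons l1 (d, u).
  have wl1u : well_deg l1u by rewrite /l1u -cats1; apply: well_deg_cat.
  have wt1u : weight l1u = (weight l1 + d.+1)%N.
    by rewrite /l1u -cats1 weight_cat /= addn0.
  have p1 := IHl l1u; rewrite size_rcons addSnnS wt1u -addnA in p1.
  have {}p1 := p1 le_m wl1u wl2.
  have p2 := poly_mean_mul pu (poly_mean_add
     (poly_mean_le (leq_pred _) (IHl l1 (leqW le_m') wl1 wl2))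
     (_ : poly_mean _ (path_prod (l1 ++ l2)))).
  have {}p2 : poly_mean (d + (weight l1 + weight l2)) (fun w => u (ones w) (zeros w)
     * (path_prod l1 w * (path_prod_incl l2 w - path_prod l2 w)
        + path_prod (l1 ++ l2) w)).
    apply: p2; rewrite -weight_cat; apply: IHm; first by rewrite size_cat.
    exact: well_deg_cat.
  have le2 : (d + (weight l1 + weight l2) <= (weight l1 + (d.+1 + weight l2)).-1)%N.
    by lia.
  apply: poly_mean_ext (poly_mean_add p1 (poly_mean_le le2 p2)) => w /=.
  by rewrite /l1u -cats1 !path_prod_cat /= mulr1; ring.
case: l => [|[d u] l] le_m wl; first exact: poly_mean_const.
apply: (poly_mean_step (R := fun w => path_prod [::] w *
  (path_prod_incl ((d, u) :: l) w - path_prod ((d, u) :: l) w))).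
- by rewrite /= path_sum_nil mul0r.
- by move=> w b; rewrite path_prod_rcons [path_prod [::] w]/= mul1r addrC subrK.
- exact: (diff [::] ((d, u) :: l) le_m I wl).
Qed.

(** * Polynomials in the endpoint and the path sums *)

Inductive path_poly (d : nat) : (bitseq -> rat) -> Prop :=
| PathPoly0 F : (forall w, F w = 0) -> path_poly d F
| PathPolyS F G e p l : polyd e p -> well_deg l -> (e + weight l <= d)%N ->
    path_poly d G ->
    (forall w, F w = p (ones w) (zeros w) * path_prod l w + G w) ->
    path_poly d F.

Lemma path_poly_mean d F : path_poly d F -> poly_mean d F.
Proof.
elim=> [{}F F0|{}F G e p l pp wl le_d _ IH FE].
  by apply: poly_mean_ext (poly_mean_const d 0) => w; rewrite F0.
apply: poly_mean_ext (poly_mean_add (poly_mean_le le_d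
  (poly_mean_mul pp (poly_mean_path_prod wl))) IH) => w.
by rewrite FE.
Qed.

Lemma path_poly_ext d F G : F =1 G -> path_poly d F -> path_poly d G.
Proof.
move=> FG pF; case: pF FG => [{}F F0|{}F H e p l pp wl le_d pH FE] FG.
  by apply: PathPoly0 => w; rewrite -FG F0.
by apply: PathPolyS pp wl le_d pH _ => w; rewrite -FG FE.
Qed.

Lemma path_poly_term d e p l : polyd e p -> well_deg l ->
  (e + weight l <= d)%N ->
  path_poly d (fun w => p (ones w) (zeros w) * path_prod l w).
Proof.
move=> pp wl le_d.
apply: (PathPolyS (G := fun _ => 0) pp wl le_d); first exact: PathPoly0.
by move=> w; rewrite addr0.
Qed.

Lemma path_poly_add d F G :
  path_poly d F -> path_poly d G -> path_poly d (fun w => F w + G w).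
Proof.
move=> pF pG; elim: pF => [{}F F0|{}F H e p l pp wl le_d _ IH FE].
  by apply: path_poly_ext pG => w; rewrite F0 add0r.
by apply: PathPolyS pp wl le_d IH _ => w; rewrite FE addrA.
Qed.

Lemma path_poly_mul d e F G :
  path_poly d F -> path_poly e G -> path_poly (d + e) (fun w => F w * G w).
Proof.
move=> pF pG; elim: pF => [{}F F0|{}F H a p l pp wl le_d _ IH FE].
  by apply: PathPoly0 => w; rewrite F0 mul0r.
apply: (path_poly_ext (F := fun w =>
  p (ones w) (zeros w) * path_prod l w * G w + H w * G w)).
  by move=> w; rewrite FE mulrDl.
apply: path_poly_add IH.
elim: pG => [{}G G0|{}G K b q l' pq wl' le_e _ IH GE].
  by apply: PathPoly0 => w; rewrite G0 mulr0.
apply: (path_poly_ext (F := fun w =>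
  p (ones w) (zeros w) * q (ones w) (zeros w) * path_prod (l ++ l') w
  + p (ones w) (zeros w) * path_prod l w * K w)).
  by move=> w; rewrite GE path_prod_cat; ring.
apply: path_poly_add IH.
apply: (path_poly_term (p := fun x y => p x y * q x y) (polyd_mul pp pq)).
  exact: well_deg_cat.
by rewrite weight_cat addnACA leq_add.
Qed.

Lemma path_poly_exp d k F :
  path_poly d F -> path_poly (k * d) (fun w => F w ^+ k).
Proof.
move=> pF; elim: k => [|k IH].
  apply: (path_poly_ext (F := fun w => 1 * path_prod [::] w)) => [w|].
    by rewrite mulr1 expr0.
  exact: (path_poly_term (polyd_const 0 1)).
by apply: path_poly_ext (path_poly_mul pF IH) => w; rewrite exprS.
Qed.

Lemma path_poly_endpoint d p :
  polyd d p -> path_poly d (fun w => p (ones w) (zeros w)).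
Proof.
move=> pp; apply: (path_poly_ext (F := fun w =>
  p (ones w) (zeros w) * path_prod [::] w)) => [w|].
  by rewrite mulr1.
by apply: path_poly_term pp _ _ => //; rewrite addn0.
Qed.

Lemma path_poly_path_sum d u : polyd d u -> path_poly d.+1 (path_sum u).
Proof.
move=> pu; apply: (path_poly_ext (F := fun w =>
  1 * path_prod [:: (d, u)] w)) => [w|].
  by rewrite /= mul1r mulr1.
by apply: (path_poly_term (polyd_const 0 1)) => //=; rewrite addn0 add0n.
Qed.

(** * Exact joint moments for short words *)

(** Binary integers carry the computation and rationals the statements; [zr] passes from the former
    to the latter. *)
Definition zr (z : Z) : rat := (int_of_Z z)%:~R.

Lemma zrD a b : zr (Z.add a b) = zr a + zr b.
Proof. by rewrite /zr (rmorphD int_of_Z) intrD. Qed.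

Lemma zrM a b : zr (Z.mul a b) = zr a * zr b.
Proof. by rewrite /zr (rmorphM int_of_Z) intrM. Qed.

Lemma zrN a : zr (Z.opp a) = - zr a.
Proof. by rewrite /zr (rmorphN int_of_Z) intrN. Qed.

Lemma zrB a b : zr (Z.sub a b) = zr a - zr b.
Proof. by rewrite /Z.sub zrD zrN. Qed.

Lemma zr_nat n : zr (Z.of_nat n) = n%:R.
Proof. by elim: n => // n IH; rewrite Nat2Z.inj_succ /Z.succ zrD IH -natr1. Qed.

Lemma zr_inj : injective zr.
Proof. by move=> a b /intr_inj /(can_inj int_of_ZK). Qed.

Lemma zr_neq0 z : z <> 0%zz -> zr z != 0.
Proof. by move=> z0; apply/eqP => /(@zr_inj z 0%zz). Qed.

Definition zlin (u a b : Z) : Z := Z.add a (Z.mul u b).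

Section Tables.
Variable A : Type.

Fixpoint map2 (f : A -> A -> A) (m1 m2 : seq A) : seq A :=
  match m1, m2 with
  | a :: m1', b :: m2' => f a b :: map2 f m1' m2'
  | _, _ => [::]
  end.

(* If [m] lists the moments of [1, G, G^2, ...] and [lin a b] computes
   [a + u b], this lists the moments of the powers of [G + u]. *)
Fixpoint shift (lin : A -> A -> A) (k : nat) (m : seq A) : seq A :=
  match k, m with
  | k'.+1, a :: m' => a :: shift lin k' (map2 lin m' m)
  | _, _ => [::]
  end.

Variable ws : seq bitseq.
Variable ok : (bitseq -> rat) -> A -> Prop.

(** The function [F] is a weight: entry [k] describes [F * G ^ k]. As [ok] is arbitrary, an entry
    can itself be a table in another variable, which gives joint moments. *)
Fixpoint moments (G F : bitseq -> rat) (m : seq A) : Prop :=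
  if m is a :: m' then ok F a /\ moments G (fun w => F w * G w) m' else True.

Definition ok_ext := forall F G a,
  {in ws, F =1 G} -> ok F a -> ok G a.

Definition ok_lin (lin : A -> A -> A) (u : Z) := forall F G a b,
  ok F a -> ok G b -> ok (fun w => F w + zr u * G w) (lin a b).

Hypothesis okE : ok_ext.

Lemma moments_ext G G' F F' m : {in ws, F =1 F'} -> {in ws, G =1 G'} ->
  moments G F m -> moments G' F' m.
Proof.
elim: m F F' => //= a m IH F F' FF' GG' [okF mF]; split; first exact: okE okF.
by apply: (IH _ _ _ GG' mF) => w wws; rewrite FF' // GG'.
Qed.

Lemma moments_lin lin u G F F' m m' : ok_lin lin u ->
  moments G F m -> moments G F' m' ->
  moments G (fun w => F w + zr u * F' w) (map2 lin m m').
Proof.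
move=> linP; elim: m m' F F' => [|a m IH] [|a' m'] F F' //= [okF mF] [okF' mF'].
split; first exact: linP.
by apply: moments_ext (IH _ _ _ mF mF') => // w _; rewrite mulrDl mulrA.
Qed.

Lemma moments_behead G F m :
  moments G F m -> moments G (fun w => F w * G w) (behead m).
Proof. by case: m => //= a m []. Qed.

(** One step passes from the weight [F] to [F * (G + u)], whose table is the tail of the old table
    plus [u] times the old table. *)
Lemma moments_shift lin u G G' F k m : ok_lin lin u ->
  {in ws, forall w, G' w = G w + zr u} ->
  moments G F m -> moments G' F (shift lin k m).
Proof.
move=> linP GG'; elim: k m F => [|k IH] [|a m] F //= [okF mF]; split=> //.
apply: IH; apply: (moments_ext (F := fun w => F w * G w + zr u * F w) (G := G)) => //.
  by move=> w wws; rewrite GG' // mulrDr [F w * zr u]mulrC.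
by apply: moments_lin.
Qed.

Lemma moments_map_mul (f : A -> A) H G F m :
  (forall F a, ok F a -> ok (fun w => F w * H w) (f a)) ->
  moments G F m -> moments G (fun w => F w * H w) (map f m).
Proof.
move=> fP; elim: m F => //= a m IH F [okF mF]; split; first exact: fP.
by apply: moments_ext (IH _ mF) => // w _; rewrite mulrAC.
Qed.

End Tables.

Lemma moments_map A B (ok : (bitseq -> rat) -> A -> Prop)
    (ok' : (bitseq -> rat) -> B -> Prop) (f : A -> B) G F m :
  (forall F a, ok F a -> ok' F (f a)) ->
  moments ok G F m -> moments ok' G F (map f m).
Proof.
by move=> fP; elim: m F => //= a m IH F [okF mF]; split; [apply: fP | apply: IH].
Qed.

Lemma moments_comp A (ok ok' : (bitseq -> rat) -> A -> Prop)
    (r : bitseq -> bitseq) G F m :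
  (forall F a, ok (F \o r) a -> ok' F a) ->
  moments ok (G \o r) (F \o r) m -> moments ok' G F m.
Proof.
move=> rP; elim: m F => //= a m IH F [okF mF]; split; first exact: rP.
exact: IH.
Qed.

Lemma moments_cat A (ok1 ok2 ok12 : (bitseq -> rat) -> A -> Prop)
    (add : A -> A -> A) G F m1 m2 :
  (forall F a b, ok1 F a -> ok2 F b -> ok12 F (add a b)) ->
  moments ok1 G F m1 -> moments ok2 G F m2 ->
  moments ok12 G F (map2 add m1 m2).
Proof.
move=> addP; elim: m1 m2 F => [|a m1 IH] [|b m2] F //= [okF mF] [okF' mF'].
by split; [apply: addP | apply: IH].
Qed.

Definition lin1 (u : Z) : seq Z -> seq Z -> seq Z := map2 (zlin u).
Definition lin2 (u : Z) : seq (seq Z) -> seq (seq Z) -> seq (seq Z) :=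
  map2 (lin1 u).
Definition lin3 (u : Z) :
  seq (seq (seq Z)) -> seq (seq (seq Z)) -> seq (seq (seq Z)) := map2 (lin2 u).

Section Moments.
Variable ws : seq bitseq.

Definition ok0 (F : bitseq -> rat) (z : Z) : Prop := \sum_(w <- ws) F w = zr z.
Definition ok1 (U : bitseq -> rat) := moments ok0 U.
Definition ok2 (U V : bitseq -> rat) := moments (ok1 U) V.
Definition ok3 (U V W : bitseq -> rat) := moments (ok2 U V) W.

Lemma ok0_ext : ok_ext ws ok0.
Proof. by move=> F G a FG; rewrite /ok0 => <-; apply/esym/eq_big_seq. Qed.

Lemma ok1_ext U : ok_ext ws (ok1 U).
Proof. by move=> F G a FG; apply: moments_ext ok0_ext _ _ _ _ _ FG _. Qed.

Lemma ok2_ext U V : ok_ext ws (ok2 U V).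
Proof. by move=> F G a FG; apply: moments_ext (@ok1_ext U) _ _ _ _ _ FG _. Qed.

Lemma ok0_lin u : ok_lin ok0 (zlin u) u.
Proof.
by move=> F G a b; rewrite /ok0 /zlin zrD zrM big_split -mulr_sumr => -> ->.
Qed.

Lemma ok1_lin U u : ok_lin (ok1 U) (lin1 u) u.
Proof. by move=> F G a b; apply: (moments_lin ok0_ext); apply: ok0_lin. Qed.

Lemma ok2_lin U V u : ok_lin (ok2 U V) (lin2 u) u.
Proof. by move=> F G a b; apply: (moments_lin (@ok1_ext U)); apply: ok1_lin. Qed.

End Moments.

Definition moment_table (ws : seq bitseq) :=
  ok3 ws (path_sum (fun x _ => x%:R)) (path_sum (fun x _ => x%:R ^+ 2))
    (path_sum (fun x y => x%:R * (x + y)%:R)).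

(* The truncation [e + 2 b + 2 c <= 12] keeps exactly the moments
   [U^e V^b W^c] that occur in the sixth power of a combination of [U^2], [U],
   [V] and [W], the path sums of [x], [x^2] and [x (x + y)]. *)
Definition initial_table : seq (seq (seq Z)) :=
  [seq [seq [seq if (c + b + e)%N is 0%N then 1%zz else 0%zz
            | e <- iota 0 (13 - 2 * (b + c))]
       | b <- iota 0 (7 - c)] | c <- iota 0 7].

Lemma moment_table0 : moment_table (words 0 0) (fun _ => 1) initial_table.
Proof.
rewrite /moment_table /ok3 /ok2 /ok1 /ok0 /=.
repeat split; rewrite big_seq1 ?path_sum_nil ?mulr0 //.
Qed.

(** A letter appended to a word of length [i] with [x] ones raises the three path sums by [x],
    [x ^ 2] and [i x]. The increments do not depend on the letter, so one table serves both
    extensions. *)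
Definition next_table (i x : Z) (T : seq (seq (seq Z))) : seq (seq (seq Z)) :=
  shift (lin2 (Z.mul i x)) 7
    (map (shift (lin1 (Z.mul x x)) 7) (map (map (shift (zlin x) 13)) T)).

Lemma moment_table_next n x b T :
  moment_table (words n x) (fun _ => 1) T ->
  moment_table [seq rcons w b | w <- words n x] (fun _ => 1)
    (next_table (Z.of_nat n) (Z.of_nat x) T).
Proof.
set ws := words n x; set U := path_sum (fun x _ => x%:R).
set V := path_sum (fun x _ => x%:R ^+ 2).
set W := path_sum (fun x y => x%:R * (x + y)%:R) => TP.
pose r := rcons^~ b.
have wsE w : w \in ws -> ones w = x /\ (ones w + zeros w = n)%N.
  rewrite mem_words => /andP [/eqP sw /eqP <-]; split=> //.
  by rewrite /zeros sw subnKC // -sw ones_le.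
have Ur : {in ws, forall w, (U \o r) w = U w + zr (Z.of_nat x)}.
  by move=> w /wsE [wx _]; rewrite /= /U path_sum_rcons wx zr_nat.
have Vr : {in ws, forall w, (V \o r) w = V w + zr (Z.mul (Z.of_nat x) (Z.of_nat x))}.
  by move=> w /wsE [wx _]; rewrite /= /V path_sum_rcons wx zrM zr_nat expr2.
have Wr : {in ws, forall w, (W \o r) w = W w + zr (Z.mul (Z.of_nat n) (Z.of_nat x))}.
  move=> w /wsE [wx wn]; rewrite /= /W path_sum_rcons wn wx zrM !zr_nat.
  by rewrite [_%:R * n%:R]mulrC.
suff: ok3 ws (U \o r) (V \o r) (W \o r) (fun _ => 1)
    (next_table (Z.of_nat n) (Z.of_nat x) T).
  apply: moments_comp => F a; apply: moments_comp => {a}F a.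
  by apply: moments_comp => {a}F a; rewrite /ok0 big_map.
apply: (moments_shift (@ok2_ext ws _ _) _ (@ok2_lin ws _ _ _) Wr).
apply: moments_map (_ : ok3 ws (U \o r) V W (fun _ => 1) _).
  by move=> F a; apply: (moments_shift (@ok1_ext ws _) _ (@ok1_lin ws _ _) Vr).
apply: moments_map TP => F a; apply: moments_map => {a}F a.
exact: (moments_shift (@ok0_ext ws) _ (@ok0_lin ws _) Ur).
Qed.

Fixpoint next_cells (i x : Z) (lv : seq (seq (seq (seq Z)))) :=
  if lv is T :: lv' then next_table i x T :: next_cells i (Z.add x 1) lv'
  else [::].

(** Pascal's rule: a new cell adds the extensions by a zero of the words with as many ones and the
    extensions by a one of the words with one fewer. *)
Fixpoint merge_cells (T : seq (seq (seq Z))) (lv : seq (seq (seq (seq Z)))) :=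
  if lv is T' :: lv' then lin3 1 T' T :: merge_cells T' lv' else [:: T].

Definition next_level (i : Z) (lv : seq (seq (seq (seq Z)))) :=
  if next_cells i 0 lv is T :: lv' then T :: merge_cells T lv' else [::].

Fixpoint level_ok (n x : nat) (lv : seq (seq (seq (seq Z)))) : Prop :=
  if lv is T :: lv' then
    moment_table (words n x) (fun _ => 1) T /\ level_ok n x.+1 lv'
  else True.

Lemma moment_table_add n x T1 T2 :
  moment_table [seq rcons w false | w <- words n x.+1] (fun _ => 1) T1 ->
  moment_table [seq rcons w true | w <- words n x] (fun _ => 1) T2 ->
  moment_table (words n.+1 x.+1) (fun _ => 1) (lin3 1 T1 T2).
Proof.
apply: moments_cat => F a b; apply: moments_cat => {a b}F a b.
apply: moments_cat => {a b}F a b; rewrite /ok0 /= big_cat => -> ->.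
by rewrite /zlin zrD zrM mul1r.
Qed.

(* A level lists the cells [x = 0, ..., n]: beyond [x = n] there are no words. *)
Lemma level_ok_next n lv : size lv = n.+1 ->
  level_ok n 0 lv -> level_ok n.+1 0 (next_level (Z.of_nat n) lv).
Proof.
case: lv => // T lv [size_lv] [TP lvP]; split.
  by rewrite /= cats0; apply: (@moment_table_next n 0 false) TP.
rewrite -[Z.add 0 1]/(Z.of_nat 1) -[0%zz]/(Z.of_nat 0).
move: size_lv lvP TP; rewrite -{1}[n]subn0.
move: 0%N (leq0n n) => x; elim: lv x T => [|T' lv IH] x T le_xn /=.
  move=> size_lv _ TP; split=> //.
  have xn : x = n by lia.
  have w0 : words n x.+1 = [::].
    case E: (words n x.+1) => [//|w ws'].
    have: w \in words n x.+1 by rewrite E mem_head.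
    rewrite mem_words => /andP [/eqP sw /eqP ow].
    by have := ones_le w; rewrite sw ow xn ltnn.
  by rewrite /moment_table /= w0; apply: (@moment_table_next n x true) TP.
move=> size_lv [T'P lvP] TP; split.
  by apply: moment_table_add; apply: moment_table_next.
have xE : Z.add (Z.of_nat x.+1) 1 = Z.of_nat x.+2 by lia.
rewrite /= in xE; rewrite xE.
by apply: (IH x.+1) => //; lia.
Qed.

Lemma size_next_level n lv : size lv = n.+1 ->
  size (next_level (Z.of_nat n) lv) = n.+2.
Proof.
have size_next i x l : size (next_cells i x l) = size l.
  by elim: l x => //= T l IH x; rewrite IH.
have size_merge T l : size (merge_cells T l) = (size l).+1.
  by elim: l T => //= T' l IH T; rewrite IH.
by case: lv => //= T lv [size_lv]; rewrite size_merge size_next size_lv.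
Qed.

(** * Multiplying the weight of a table by the centred statistic *)

Section Recentre.
Variables n s t : Z.

(** The constant term of [24] times the centred statistic. A factor [U], [V] or [W] drops the head
    of the table in its own direction, so each multiplication lowers the bound on [e + 2 b + 2 c] by
    two, and six of them exhaust the bound [12]. *)
Definition recentre_const : Z :=
  ((s * s - 1) * (n * n - 1) - (s - 1) * (t - 1) * (n + 1))%zz.

Definition recentre_row (r : seq Z) : seq Z :=
  lin1 recentre_const (lin1 (12 * s * (n - 1))%zz
    (map (Z.mul (-12)) (behead (behead r))) (behead r)) r.

Definition recentre_plane (P : seq (seq Z)) : seq (seq Z) :=
  map2 (lin1 (12 * n)%zz) (map recentre_row P) (behead P).

Definition recentre (T : seq (seq (seq Z))) : seq (seq (seq Z)) :=
  map2 (lin2 (-24 * s)%zz) (map recentre_plane T) (behead T).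

Lemma recentreP ws U V W F T : ok3 ws U V W F T ->
  ok3 ws U V W (fun w => F w * (zr 12 * (zr n * V w - U w ^+ 2
     - zr 2 * zr s * W w + zr s * (zr n - 1) * U w) + zr recentre_const))
   (recentre T).
Proof.
have scaleP k F' r : ok1 ws U F' r -> ok1 ws U (fun w => F' w * zr k) (map (Z.mul k) r).
  apply: moments_map_mul => [|{}F' a]; first exact: ok0_ext.
  by rewrite /ok0 zrM -mulr_suml => ->; rewrite mulrC.
have rowP F' r : ok1 ws U F' r -> ok1 ws U (fun w => F' w * (zr (-12) * U w ^+ 2
    + zr (12 * s * (n - 1))%zz * U w + zr recentre_const)) (recentre_row r).
  move=> rP; apply: (ok1_ext (F := fun w => F' w * U w * U w * zr (-12)
      + zr (12 * s * (n - 1))%zz * (F' w * U w) + zr recentre_const * F' w)).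
    by move=> w _; ring.
  apply: ok1_lin (rP); apply: ok1_lin (moments_behead rP).
  by apply: scaleP; apply/moments_behead/moments_behead.
have planeP F' P : ok2 ws U V F' P -> ok2 ws U V (fun w => F' w * (zr (-12) * U w ^+ 2
    + zr (12 * s * (n - 1))%zz * U w + zr recentre_const + zr (12 * n)%zz * V w))
    (recentre_plane P).
  move=> PP; apply: (ok2_ext (F := fun w => F' w * (zr (-12) * U w ^+ 2
      + zr (12 * s * (n - 1))%zz * U w + zr recentre_const)
      + zr (12 * n)%zz * (F' w * V w))).
    by move=> w _; ring.
  apply: (moments_lin (@ok1_ext ws U) (@ok1_lin ws U _) _ (moments_behead PP)).
  by apply: (moments_map_mul (@ok1_ext ws U) rowP PP).
move=> TP; apply: (moments_ext (@ok2_ext ws U V) (G := W) (F := fun w => F w *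
    (zr (-12) * U w ^+ 2 + zr (12 * s * (n - 1))%zz * U w + zr recentre_const
    + zr (12 * n)%zz * V w) + zr (-24 * s)%zz * (F w * W w))) => //.
  move=> w _; rewrite !zrM zrB (_ : zr (-12) = - zr 12) //.
  by rewrite (_ : zr (-24) = - (zr 12 * zr 2)) // (_ : zr 1 = 1) //; ring.
apply: (moments_lin (@ok2_ext ws U V) (@ok2_lin ws U V _) _ (moments_behead TP)).
by apply: (moments_map_mul (@ok2_ext ws U V) planeP TP).
Qed.

End Recentre.

(** * The moments of the size statistic *)

(** Coefficients with the exponents of [s] and [t], as data: the degree bound is then a check on a
    list, and values can be computed in binary. *)
Definition P6_terms : seq (Z * nat * nat) :=
  [:: (307561%zz, 8, 4); (1230244%zz, 7, 5); (1845366%zz, 6, 6); (1230244%zz, 5, 7);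
      (307561%zz, 4, 8); ((-2056306)%zz, 8, 3); ((-8225224)%zz, 7, 4);
      ((-14394142)%zz, 6, 5); ((-14394142)%zz, 5, 6); ((-8225224)%zz, 4, 7);
      ((-2056306)%zz, 3, 8); (5372061%zz, 8, 2); (21488244%zz, 7, 3);
      (42976488%zz, 6, 4); (53720610%zz, 5, 5); (42976488%zz, 4, 6); (21488244%zz, 3, 7);
      (5372061%zz, 2, 8); ((-6453396)%zz, 8, 1); ((-25813584)%zz, 7, 2);
      ((-60704054)%zz, 6, 3); ((-91764618)%zz, 5, 4); ((-91764618)%zz, 4, 5);
      ((-60704054)%zz, 3, 6); ((-25813584)%zz, 2, 7); ((-6453396)%zz, 1, 8);
      (2985120%zz, 8, 0); (11940480%zz, 7, 1); (39743142%zz, 6, 2); (77437746%zz, 5, 3);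
      (96285048%zz, 4, 4); (77437746%zz, 3, 5); (39743142%zz, 2, 6); (11940480%zz, 1, 7);
      (2985120%zz, 0, 8); ((-11104272)%zz, 6, 1); ((-33312816)%zz, 5, 2);
      ((-55521360)%zz, 4, 3); ((-55521360)%zz, 3, 4); ((-33312816)%zz, 2, 5);
      ((-11104272)%zz, 1, 6); (2985120%zz, 6, 0); (8955360%zz, 5, 1);
      (23840061%zz, 4, 2); (32754522%zz, 3, 3); (23840061%zz, 2, 4); (8955360%zz, 1, 5);
      (2985120%zz, 0, 6); ((-9109476)%zz, 4, 1); ((-18218952)%zz, 3, 2);
      ((-18218952)%zz, 2, 3); ((-9109476)%zz, 1, 4); (2985120%zz, 4, 0);
      (5970240%zz, 3, 1); (8955360%zz, 2, 2); (5970240%zz, 1, 3); (2985120%zz, 0, 4);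
      (8664840%zz, 2, 1); (8664840%zz, 1, 2); ((-62687520)%zz, 2, 0);
      ((-62687520)%zz, 1, 1); ((-62687520)%zz, 0, 2); (626875200%zz, 0, 0)].
Definition P6_eval (s t : rat) : rat :=
  \sum_(m <- P6_terms) zr m.1.1 * s ^+ m.1.2 * t ^+ m.2.

(** A large literal is kept as a string of decimal digits; reading the same digits as a binary
    integer avoids its unary expansion. *)
Lemma zr_num_uint (u : Decimal.uint) (z : Z) :
  Z.of_uint u = z -> zr z = (Nat.of_num_uint (Number.UIntDecimal u))%:R.
Proof.
move=> <-; rewrite /Nat.of_num_uint -uint_N_nat -zr_nat; congr zr.
by rewrite -[Z.of_uint u]/(Z.of_N (N.of_uint u)); move: (N.of_uint u) => k; lia.
Qed.

Lemma P6E s t : P6 s t = P6_eval s t.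
Proof.
rewrite /P6_eval unlock /= /P6.
(* [generalize] matches constants syntactically; [rewrite] would try to unify
   different ones, computing them in unary. *)
repeat match goal with |- context [(Nat.of_num_uint (Number.UIntDecimal ?u))%:R] =>
  let z := eval vm_compute in (Z.of_uint u) in
  generalize (@zr_num_uint u z erefl);
  generalize ((Nat.of_num_uint (Number.UIntDecimal u))%:R : rat) => ? <- end.
repeat match goal with |- context [zr (Z.neg ?p)] =>
  rewrite -[Z.neg p]/(Z.opp (Z.pos p)) zrN end.
(* With [zr] abstract the coefficients are atoms, and the two sides are compared coefficient by
   coefficient. *)
by move: zr => z; ring.
Qed.

Definition sixth_poly (x y : nat) : rat :=
  1 / 4184557977600%:R * x%:R * y%:R * (y%:R - 1) * (x%:R - 1)
    * (x%:R + y%:R + 1) * (x%:R + y%:R) * P6 x%:R y%:R.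

(** Armstrong's formula for the average size of an [(s, t)]-core. *)
Definition mean_poly (x y : nat) : rat :=
  (x%:R - 1) * (y%:R - 1) * (x%:R + y%:R + 1) / 24%:R.

(** Half the variance of the heights, minus [(n ^ 2 - 1) / 24], expanded in path sums so that its
    degree can be read off; [size_statE] recovers the variance. *)
Definition size_stat (w : bitseq) : rat :=
  let s : rat := (ones w)%:R in let n : rat := (ones w)%:R + (zeros w)%:R in
  (n * path_sum (fun x _ => x%:R ^+ 2) w - path_sum (fun x _ => x%:R) w ^+ 2
   - 2%:R * s * path_sum (fun x y => x%:R * (x + y)%:R) w
   + s * (n - 1) * path_sum (fun x _ => x%:R) w) / 2%:R
  + (s ^+ 2 - 1) * (n ^+ 2 - 1) / 24%:R.

Definition centred_stat (w : bitseq) : rat :=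
  size_stat w - mean_poly (ones w) (zeros w).

(** The path sum [U] has degree [2] and [V], [W] have degree [3], so [n V], [U ^ 2], [s W] and
    [s (n - 1) U] all have degree at most [4], as has the endpoint term. *)
Lemma path_poly_centred : path_poly 4 centred_stat.
Proof.
pose U := path_sum (fun x _ => x%:R); pose V := path_sum (fun x _ => x%:R ^+ 2).
pose W := path_sum (fun x y => x%:R * (x + y)%:R).
have pXY : polyd 1 (fun x y => x%:R + y%:R) by apply: polyd_add polydX polydY.
have pU : path_poly 2 U by apply: path_poly_path_sum polydX.
have pV : path_poly 3 V.
  exact: path_poly_path_sum (polyd_exp (f := fun x _ => x%:R) 2 polydX).
have pW : path_poly 3 W.
  apply: path_poly_path_sum; apply: polyd_ext (polyd_mul polydX pXY) => x y.
  by rewrite natrD.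
pose e x y : rat := (x%:R ^+ 2 - 1) * ((x%:R + y%:R) ^+ 2 - 1) / 24%:R - mean_poly x y.
have pe : polyd 4 e.
  apply: polyd_sub.
    apply: (polyd_mul (d := 4) (e := 0) _ (polyd_const _ _)).
    apply: (polyd_mul (d := 2) (e := 2)); apply: polyd_sub (polyd_const _ _).
      exact: (polyd_exp (f := fun x _ => x%:R) 2 polydX).
    exact: (polyd_exp (f := fun x y => x%:R + y%:R) 2 pXY).
  apply: (polyd_mul (d := 4) (e := 0) _ (polyd_const _ _)).
  apply: (polyd_le (d := 3)) => //; apply: (polyd_mul (d := 2) (e := 1)).
    apply: (polyd_mul (d := 1) (e := 1)).
      exact: polyd_sub polydX (polyd_const _ _).
    exact: polyd_sub polydY (polyd_const _ _).
  exact: polyd_add pXY (polyd_const _ _).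
have cE w : centred_stat w = ((ones w)%:R + (zeros w)%:R) / 2%:R * V w
    + ((- 1 / 2%:R) * (U w ^+ 2) + (- (ones w)%:R * W w
    + ((ones w)%:R * ((ones w)%:R + (zeros w)%:R - 1) / 2%:R * U w
    + e (ones w) (zeros w)))).
  rewrite /centred_stat /size_stat -/U -/V -/W /e.
  by move: (mean_poly _ _) => m; field.
apply: path_poly_ext (fun w => esym (cE w)) _.
apply: path_poly_add.
  apply: (path_poly_mul (d := 1) (e := 3)) pV.
  apply: (path_poly_endpoint (p := fun x y => (x%:R + y%:R) / 2%:R)).
  exact: (polyd_mul (e := 0) pXY (polyd_const _ _)).
apply: path_poly_add.
  apply: (path_poly_mul (d := 0) (e := 4)) (path_poly_exp 2 pU).
  exact: (path_poly_endpoint (polyd_const _ _)).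
apply: path_poly_add.
  apply: (path_poly_mul (d := 1) (e := 3)) pW.
  exact: (path_poly_endpoint (polyd_opp polydX)).
apply: path_poly_add (path_poly_endpoint pe).
apply: (path_poly_mul (d := 2) (e := 2)) pU.
apply: (path_poly_endpoint (p := fun x y => x%:R * (x%:R + y%:R - 1) / 2%:R)).
apply: (polyd_mul (d := 2) (e := 0) _ (polyd_const _ _)).
exact: (polyd_mul (d := 1) (e := 1) polydX (polyd_sub pXY (polyd_const _ _))).
Qed.

Lemma polyd_sixth : polyd 18 sixth_poly.
Proof.
have pXY : polyd 1 (fun x y => x%:R + y%:R) by apply: polyd_add polydX polydY.
apply: (polyd_mul (d := 6) (e := 12)).
  apply: (polyd_mul (d := 5) (e := 1) _ pXY).
  apply: (polyd_mul (d := 4) (e := 1) _ (polyd_add pXY (polyd_const _ _))).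
  apply: (polyd_mul (d := 3) (e := 1) _ (polyd_sub polydX (polyd_const _ _))).
  apply: (polyd_mul (d := 2) (e := 1) _ (polyd_sub polydY (polyd_const _ _))).
  apply: (polyd_mul (d := 1) (e := 1) _ polydY).
  exact: (polyd_mul (d := 0) (e := 1) (polyd_const _ _) polydX).
apply: (polyd_ext (f := fun x y => P6_eval x%:R y%:R)).
  by move=> x y; rewrite P6E.
rewrite /P6_eval; have: all (fun m => m.1.2 + m.2 <= 12)%N P6_terms by [].
elim: P6_terms => [_|m l IH /= /andP [le_m le_l]].
  by apply: Polyd0 => x y; rewrite big_nil.
apply: (polyd_ext (f := fun x y => zr m.1.1 * x%:R ^+ m.1.2 * y%:R ^+ m.2
  + \sum_(m <- l) zr m.1.1 * x%:R ^+ m.1.2 * y%:R ^+ m.2)).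
  by move=> x y; rewrite big_cons.
apply: polyd_add (IH le_l); apply: polyd_le le_m _.
apply: polyd_mul.
  apply: (polyd_mul (d := 0) (polyd_const _ _)).
  by have := polyd_exp (f := fun x _ => x%:R) m.1.2 polydX; rewrite muln1.
by have := polyd_exp (f := fun _ y => y%:R) m.2 polydY; rewrite muln1.
Qed.

Definition P6_eval_Z (s t : Z) : Z :=
  foldr (fun m z => Z.add (iter m.2 (Z.mul t) (iter m.1.2 (Z.mul s) m.1.1)) z)
    0%zz P6_terms.

Lemma P6_eval_ZE s t : zr (P6_eval_Z s t) = P6_eval (zr s) (zr t).
Proof.
have powE k a z : zr (iter k (Z.mul a) z) = zr z * zr a ^+ k.
  by elim: k => [|k IH] /=; rewrite ?mulr1 // zrM IH exprS mulrCA.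
rewrite /P6_eval /P6_eval_Z; elim: P6_terms => [|m l IH] /=.
  by rewrite big_nil.
by rewrite big_cons zrD IH !powE.
Qed.

Definition first_moment (T : seq (seq (seq Z))) : option Z :=
  if T is ((a :: _) :: _) :: _ then Some a else None.

Lemma first_momentP ws U V W F T a :
  ok3 ws U V W F T -> first_moment T = Some a -> \sum_(w <- ws) F w = zr a.
Proof. by case: T => [|[|[|b ?] ?] ?] //= [[[H _] _] _] [<-]. Qed.

(* The factor [24] clears the denominators of [centred_stat]. *)
Definition cell_check (n s : Z) (T : seq (seq (seq Z))) : bool :=
  let t := (n - s)%zz in
  match first_moment T, first_moment (recentre n s t T),
        first_moment (iter 6 (recentre n s t) T) with
  | Some a, Some b, Some c =>
      Z.eqb b 0 &&
      Z.eqb (4184557977600 * c)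
        (24 ^ 6 * a * (s * t * (t - 1) * (s - 1) * (s + t + 1) * (s + t)
                       * P6_eval_Z s t))
  | _, _, _ => false
  end.

Fixpoint level_check (n s : Z) (lv : seq (seq (seq (seq Z)))) : bool :=
  if lv is T :: lv' then cell_check n s T && level_check n (s + 1)%zz lv'
  else true.

Fixpoint levels_check (k : nat) (n : Z) (lv : seq (seq (seq (seq Z)))) : bool :=
  level_check n 0 lv &&
  (if k is k'.+1 then levels_check k' (n + 1)%zz (next_level n lv) else true).

(** The bound [24 = 6 * 4] is the degree of the sixth power of the centred statistic, so these
    levels form the triangle that [polyd_eq0] asks for. *)
Lemma levels_check24 : levels_check 24 0 [:: initial_table].
Proof. by vm_compute. Qed.

Definition moments_at (x y : nat) : Prop :=
  wsum centred_stat x y = 0 /\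
  wsum (fun w => centred_stat w ^+ 6) x y = 'C(x + y, x)%:R * sixth_poly x y.

Lemma cell_checkP x y T : moment_table (words (x + y) x) (fun _ => 1) T ->
  cell_check (Z.of_nat (x + y)) (Z.of_nat x) T -> moments_at x y.
Proof.
set ws := words _ _ => TP.
rewrite /cell_check (_ : (_ - _)%zz = Z.of_nat y); last by lia.
set n := Z.of_nat (x + y); set s := Z.of_nat x; set t := Z.of_nat y.
(* An opaque [24]: conversion would compute its powers in unary. *)
have [k24 E24] : {k : rat | k = 24%:R} by exists 24%:R.
have n24 : k24 != 0 by rewrite E24.
have z24 : zr 24 = k24 by rewrite E24.
have z12 : zr 12 = 12%:R by [].
have z2 : zr 2 = 2%:R by [].
have z1 : zr 1 = 1 by [].
have statE F T' : moment_table ws F T' ->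
    moment_table ws (fun w => F w * (k24 * centred_stat w)) (recentre n s t T').
  move=> T'P; apply: (moments_ext (@ok2_ext ws _ _) _ _ (recentreP n s t T'P)) => //.
  move=> w /words_zeros [wx wy]; congr (_ * _).
  rewrite /centred_stat /size_stat /mean_poly wx wy /recentre_const.
  rewrite !(zrB, zrM, zrD) !zr_nat natrD.
  by rewrite z12 z2 z1 E24; field.
have iterE k : moment_table ws (fun w => (k24 * centred_stat w) ^+ k)
    (iter k (recentre n s t) T).
  elim: k => [|k IH]; first exact: TP.
  apply: (moments_ext (@ok2_ext ws _ _) _ _ (statE _ _ IH)) => // w _.
  by rewrite exprSr.
case Ea: first_moment => [a|//]; case Eb: first_moment => [b|//].
case Ec: first_moment => [c|//] /andP [/Z.eqb_eq b0 /Z.eqb_eq cE].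
have a_sum := first_momentP TP Ea.
have b_sum := first_momentP (iterE 1%N) Eb.
have c_sum := first_momentP (iterE 6%N) Ec.
have {a_sum} aE : zr a = 'C(x + y, x)%:R.
  by rewrite -a_sum big_const_seq count_predT iter_addr addr0 size_words.
split.
  apply: (mulfI n24); rewrite mulr0 /wsum mulr_sumr -/ws.
  by rewrite b0 in b_sum.
have pow24 : zr (24 ^ 6) = k24 ^+ 6.
  rewrite -[(24 ^ 6)%zz]/(24 * (24 * (24 * (24 * (24 * 24)))))%zz !zrM.
  by rewrite z24 !exprS expr0 mulr1.
apply: (mulfI (expf_neq0 6 n24)); rewrite /wsum mulr_sumr -/ws.
have -> : \sum_(w <- ws) k24 ^+ 6 * centred_stat w ^+ 6 = zr c.
  by rewrite -c_sum; apply: eq_bigr => w _; rewrite exprMn.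
have nD : zr 4184557977600 != 0 by apply: zr_neq0.
move: cE nD pow24; rewrite /sixth_poly P6E.
(* The common denominator is exchanged for its binary form and then turned into a variable, so that
   it is never expanded. *)
match goal with |- context [GRing.natmul ?o (Nat.of_num_uint (Number.UIntDecimal ?u))] =>
  generalize (@zr_num_uint u 4184557977600 erefl
    : _ = GRing.natmul o (Nat.of_num_uint (Number.UIntDecimal u)));
  generalize (GRing.natmul o (Nat.of_num_uint (Number.UIntDecimal u))) end.
generalize 4184557977600%zz => D; generalize (24 ^ 6)%zz => K D' <- cE nD pow24.
apply: (mulfI nD); rewrite -zrM cE 3!zrM aE pow24 P6_eval_ZE.
by rewrite !(zrB, zrM, zrD) !zr_nat z1; move: (P6_eval _ _) => P; field.
Qed.

Lemma level_checkP n x lv : level_ok n x lv ->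
  level_check (Z.of_nat n) (Z.of_nat x) lv ->
  forall i, (i < size lv)%N -> (x + i <= n)%N -> moments_at (x + i) (n - (x + i)).
Proof.
elim: lv x => //= T lv IH x [TP lvP] /andP [TC lvC] [_ le_n|i lt_i le_n].
  rewrite addn0 in le_n *.
  by apply: cell_checkP; rewrite subnKC //; eassumption.
rewrite addnS -addSn in le_n *; apply: IH => //.
by rewrite (_ : Z.of_nat x.+1 = Z.add (Z.of_nat x) 1) //; lia.
Qed.

Lemma levels_checkP k n lv : size lv = n.+1 -> level_ok n 0 lv ->
  levels_check k (Z.of_nat n) lv ->
  forall x y, (n <= x + y <= n + k)%N -> moments_at x y.
Proof.
elim: k n lv => [|k IH] n lv size_lv lvP /= /andP [lvC lvsC] x y le_xy.
  have <- : (n - x)%N = y by lia.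
  by apply: (level_checkP lvP) => //; lia.
have [xy|xy] := eqVneq (x + y)%N n.
  have <- : (n - x)%N = y by lia.
  by apply: (level_checkP lvP) => //; lia.
apply: (IH n.+1 (next_level (Z.of_nat n) lv)) => //; last by lia.
- exact: size_next_level.
- exact: level_ok_next.
- by rewrite (_ : Z.of_nat n.+1 = Z.add (Z.of_nat n) 1) //; lia.
Qed.

(** The mean is some polynomial [q] of degree at most [d]; dividing by the nonzero binomials shows
    that [q] and [p] agree on the triangle, hence everywhere. *)
Lemma wsum_path_poly_eq d F p : path_poly d F -> polyd d p ->
  (forall x y, (x + y <= d)%N -> wsum F x y = 'C(x + y, x)%:R * p x y) ->
  forall x y, wsum F x y = 'C(x + y, x)%:R * p x y.
Proof.
move=> pF pp small x y; have [q pq qE] := path_poly_mean pF.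
rewrite qE; congr (_ * _); apply/eqP; rewrite -subr_eq0; apply/eqP.
apply: (polyd_eq0 (polyd_sub pq pp)) => i j le_ij.
have binN0 : ('C(i + j, i)%:R : rat) != 0.
  by rewrite pnatr_eq0 -lt0n bin_gt0 leq_addr.
by apply: (mulfI binN0); rewrite mulrBr -qE small // subrr mulr0.
Qed.

Theorem words_moments x y : moments_at x y.
Proof.
have small i j : (i + j <= 24)%N -> moments_at i j.
  have lv0 : level_ok 0 0 [:: initial_table] := conj moment_table0 I.
  move=> le_ij; have := @levels_checkP 24 0 [:: _] erefl lv0 levels_check24 i j.
  by rewrite leq0n; apply.
split.
  rewrite (wsum_path_poly_eq path_poly_centred (polyd_const 4 0)) ?mulr0 //.
  move=> i j le_ij; rewrite mulr0; apply: (small i j _).1.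
  exact: leq_trans le_ij _.
apply: (wsum_path_poly_eq (path_poly_exp 6 path_poly_centred)).
  exact: polyd_le polyd_sixth.
by move=> i j /small [].
Qed.

(** * Beta-sets of partitions *)

Section BetaSets.
Local Open Scope nat_scope.

(** The beta-set: the hook lengths of the first column, in decreasing order. *)
Fixpoint beta (la : seq nat) : seq nat :=
  if la is a :: la' then a + size la' :: beta la' else [::].

Fixpoint unbeta (hs : seq nat) : seq nat :=
  if hs is h :: hs' then h - size hs' :: unbeta hs' else [::].

Lemma size_beta la : size (beta la) = size la.
Proof. by elim: la => //= a la ->. Qed.

Lemma unbeta_beta la : unbeta (beta la) = la.
Proof. by elim: la => //= a la ->; rewrite size_beta addnK. Qed.

Lemma is_part_cons a la :
  is_part (a :: la) = [&& 0 < a, all (fun x => x <= a) la & is_part la].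
Proof.
rewrite /is_part /= path_sortedE; last first.
  by move=> x y z /= yx zy; apply: leq_trans zy yx.
by case: (0 < a); case: (sorted _ la); rewrite /= ?andbF ?andbT.
Qed.

Lemma beta_lt a la : all (fun x => x <= a) la ->
  forall h, h \in beta la -> h < a + size la.
Proof.
elim: la => //= b la IH /andP [le_ba /IH {}IH] h.
by rewrite inE => /orP [/eqP -> | /IH]; lia.
Qed.

Lemma beta_sorted la : is_part la -> sorted gtn (beta la).
Proof.
elim: la => //= a la IH; rewrite is_part_cons => /and3P [_ le_a /IH {}IH].
rewrite path_sortedE; last by move=> x y z /= yx zy; apply: ltn_trans zy yx.
by rewrite IH andbT; apply/allP => h /(beta_lt le_a).
Qed.

Lemma beta_gt0 la : is_part la -> 0 \notin beta la.
Proof.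
elim: la => //= a la IH; rewrite is_part_cons => /and3P [a0 _ /IH {}IH].
by rewrite inE negb_or IH andbT; lia.
Qed.

Lemma unbeta_spec hs : sorted gtn hs -> 0 \notin hs ->
  is_part (unbeta hs) /\ beta (unbeta hs) = hs.
Proof.
(* A strictly decreasing list of positive integers is at most as long as its first entry, so
   [unbeta] never truncates and yields positive parts. *)
have size_lt h r : path gtn h r -> 0 \notin h :: r -> size r < h.
  elim: r h => [|k r IH] h /=; first by rewrite inE; lia.
  move=> /andP [lt_kh pr]; rewrite inE negb_or => /andP [_ k0].
  exact: leq_ltn_trans (IH k pr k0) lt_kh.
elim: hs => //= h r IH pr hr0; have lt_h := size_lt h r pr hr0.
have /IH {}IH := path_sorted pr.
have [|pu ubr] := IH; first by move: hr0; rewrite inE negb_or => /andP [].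
have su : size (unbeta r) = size r by rewrite -[in RHS]ubr size_beta.
rewrite su ubr subnK ?(ltnW lt_h) //; split=> //.
move: pu; rewrite /is_part /= => /andP [su' ->]; rewrite subn_gt0 lt_h !andbT.
case: r {IH hr0 ubr su} pr lt_h su' => [|k r] //= /andP [lt_kh pr] lt_h ->.
by rewrite andbT; lia.
Qed.

Lemma sumn_beta la : sumn (beta la) = sumn la + 'C(size la, 2).
Proof. by elim: la => //= a la ->; rewrite binS bin1; lia. Qed.

(* The hook lengths in the row with first-column hook length [h] are the
   [h - g] for [g < h] outside the beta-set. *)
Lemma notin_betaP la g : is_part la ->
  (g \notin beta la) <-> exists k, g = count (fun x => x <= k) la + k.
Proof.
elim: la g => [|b la IH] g /=; first by split=> // _; exists g.
rewrite is_part_cons => /and3P [b0 le_b /IH {}IH].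
have countT k : b <= k -> count (fun x => x <= k) la = size la.
  move=> le_bk; apply/eqP; rewrite -all_count; apply: sub_all le_b => x.
  by move/leq_trans; apply.
rewrite inE negb_or; split.
  case/andP => gN /IH [k gE]; case: (ltngtP g (b + size la)) gN => // lt_g _.
    exists k; case: (leqP b k) => [le_bk|_]; last by rewrite gE.
    by move: lt_g; rewrite gE countT //; lia.
  exists (g - size la).-1; rewrite countT; last by lia.
  by have -> : b <= (g - size la).-1; lia.
case=> k gE; case: (leqP b k) gE => [le_bk|lt_kb] gE.
  rewrite countT // in gE; apply/andP; split; first by lia.
  by apply/negP => /(beta_lt le_b); lia.
rewrite add0n in gE; apply/andP; split; last by apply/IH; exists k.
by have := count_size (fun x => x <= k) la; lia.
Qed.

(** Adding a longest row on top raises row indices and column lengths alike by one, so the old hooks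
    keep their lengths and only those of the first row are new. *)
Lemma is_core_cons s a la : all (fun x => x <= a) la ->
  is_core s (a :: la) <-> is_core s la /\
    forall k, k < a -> (a - k.+1) + count (fun x => k < x) la + 1 <> s.
Proof.
move=> le_a; have row_le i : nth 0 la i <= a.
  have [lt_i|le_i] := ltnP i (size la); first by apply: (allP le_a); apply: mem_nth.
  by rewrite nth_default.
have hook1 k : k < a ->
    hook_length (a :: la) 1 k.+1 = (a - k.+1) + count (fun x => k < x) la + 1.
  by move=> lt_k; rewrite /hook_length /row_len /col_len /= lt_k; lia.
have hookS i j : 0 < i -> 0 < j <= row_len la i ->
    hook_length (a :: la) i.+1 j = hook_length la i j.
  case: i => // i _ /andP [j0 le_j]; rewrite /hook_length /row_len /col_len /=.
  rewrite /row_len /= in le_j.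
  by rewrite (leq_trans le_j (row_le i)) /=; lia.
split=> [core|[core row1] [//|[|i]] j].
- split=> [i j|k lt_k].
    case/andP => /andP [i0 le_i] jP; rewrite -hookS //; apply: core.
    by case: i i0 le_i jP => // i _ le_i jP; rewrite /in_ferrers /= ltnS le_i.
  by rewrite -hook1 //; apply: core; rewrite /in_ferrers /row_len /= lt_k.
- case: j => [|k]; rewrite /in_ferrers /row_len //= => lt_k.
  by rewrite hook1 //; apply: row1.
- case/andP => /andP [_ le_i] jP; rewrite hookS //.
  by apply: core; apply/andP; split.
Qed.

(** Induction on the rows: by [notin_betaP], the top row has a hook of length [s] exactly when its
    beta-number minus [s] is a natural number, possibly [0], outside the beta-set. *)
Lemma is_coreP s la : 0 < s -> is_part la ->
  is_core s la <-> forall h, h \in beta la -> s <= h -> h - s \in beta la.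
Proof.
move=> s0; elim: la => [|a la IH]; first by split=> // _ i j /andP [] /=; lia.
rewrite is_part_cons => /and3P [a0 le_a pla].
have {}IH := IH pla; rewrite is_core_cons // IH.
have countE k : count (fun x => k < x) la = size la - count (fun x => x <= k) la.
  rewrite -(count_predC (fun x => x <= k) la) addKn.
  by apply: eq_count => x /=; rewrite ltnNge.
have count_le k := count_size (fun x => x <= k) la.
have countT k : a <= k -> count (fun x => x <= k) la = size la.
  move=> le_ak; apply/eqP; rewrite -all_count; apply: sub_all le_a => x.
  by move/leq_trans; apply.
split=> [[core row1] h|core].
  rewrite inE => /orP [/eqP -> | hla] le_sh; last first.
    by rewrite inE core ?orbT.
  apply/negP => /negP; rewrite inE negb_or => /andP [_].
  case/(notin_betaP _ pla) => k gE; have lt_k : k < a.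
    by rewrite ltnNge; apply/negP => le_ak; rewrite countT // in gE; lia.
  by apply: (row1 k lt_k); rewrite countE; have := count_le k; lia.
split=> [h hla le_sh|k lt_k sE].
  have := core h; rewrite inE hla orbT => /(_ isT le_sh).
  by rewrite inE => /orP [/eqP|//]; have := beta_lt le_a hla; lia.
pose g := count (fun x => x <= k) la + k.
have gN : g \notin beta la by apply/notin_betaP => //; exists k.
rewrite countE in sE; have le_k := count_le k.
have gE : a + size la - s = g by rewrite /g; lia.
have le_s : s <= a + size la by lia.
have := core (a + size la); rewrite mem_head gE inE (negbTE gN) orbF.
by move=> /(_ isT le_s) /eqP; lia.
Qed.

End BetaSets.

(** * Cores and nonnegative words *)

Section Heights.
Local Open Scope nat_scope.

Lemma residues_perm (n : nat) (z : nat -> nat) : 0 < n ->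
  (forall i j, i < n -> j < n -> z i = z j %[mod n] -> i = j) ->
  perm_eq [seq z i %% n | i <- iota 0 n] (iota 0 n).
Proof.
move=> n0 z_inj.
have uz : uniq [seq z i %% n | i <- iota 0 n].
  rewrite map_inj_in_uniq ?iota_uniq // => i j.
  by rewrite !mem_iota /= !add0n => lt_i lt_j; apply: z_inj.
apply: uniq_perm => //; first exact: iota_uniq.
have sub : {subset [seq z i %% n | i <- iota 0 n] <= iota 0 n}.
  by move=> _ /mapP [i _ ->]; rewrite mem_iota /= add0n ltn_mod.
by have [] := uniq_min_size uz sub; rewrite ?size_map ?size_iota.
Qed.

Lemma residue_index (n : nat) (z : nat -> nat) h : 0 < n ->
  (forall i j, i < n -> j < n -> z i = z j %[mod n] -> i = j) ->
  exists2 i, i < n & z i = h %[mod n].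
Proof.
move=> n0 /(residues_perm n0) /perm_mem /(_ (h %% n)).
rewrite mem_iota /= add0n ltn_mod n0 => /mapP [i].
by rewrite mem_iota /= add0n => lt_i hE; exists i.
Qed.

Lemma prefix_ones0 w : prefix_ones w 0 = 0.
Proof. by rewrite /prefix_ones take0. Qed.

Lemma prefix_ones_size w : prefix_ones w (size w) = ones w.
Proof. by rewrite /prefix_ones take_size. Qed.

Lemma prefix_onesS w i : i < size w ->
  prefix_ones w i.+1 = prefix_ones w i + nth false w i.
Proof. by move=> lt_i; rewrite /prefix_ones (take_nth false) // ones_rcons. Qed.

(** For [s] ones and [t] zeros in all, a prefix with [a] ones and [b] zeros gets [t a - s b], the
    partial sum of the steps [+ t] and [- s]. *)
Definition height (w : bitseq) (i : nat) : int :=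
  ((size w * prefix_ones w i)%:Z - (ones w * i)%:Z)%R.

Definition nonneg_word (w : bitseq) : bool :=
  all (fun i => 0 <= height w i)%R (iota 0 (size w)).

Definition nheight (w : bitseq) (i : nat) : nat := `|height w i|.

(** The future beta-set: for each height, the smaller naturals in its class modulo the length. The
    heights become the least elements of the complement in their classes. *)
Definition height_gaps (w : bitseq) : seq nat :=
  [seq nheight w i %% size w + size w * j
  | i <- iota 0 (size w), j <- iota 0 (nheight w i %/ size w)].

Definition core_of (w : bitseq) : seq nat := unbeta (sort geq (height_gaps w)).

Variables s t : nat.
Hypotheses (s0 : 0 < s) (t0 : 0 < t) (cop_st : coprime s t).
Local Notation n := (s + t).

Lemma n_gt0 : 0 < n. Proof. by rewrite addn_gt0 s0. Qed.

Lemma coprime_ns : coprime n s.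
Proof. by rewrite coprime_sym /coprime gcdnDl. Qed.

(** The hypothesis makes [z i] congruent to [- s i], and [s] is invertible modulo [n]. *)
Lemma mod_heights_inj (z : nat -> nat) :
  (forall i, i < n -> n %| z i + s * i) ->
  forall i j, i < n -> j < n -> z i = z j %[mod n] -> i = j.
Proof.
move=> zP; suff main i j : i <= j -> j < n -> z i = z j %[mod n] -> i = j.
  move=> i j lt_i lt_j E; case: (leqP i j) => le_ij; first exact: main.
  by apply/esym/main => //; apply: ltnW.
move=> le_ij lt_j /eqP E.
have lt_i : i < n by apply: leq_ltn_trans lt_j.
have dj : n %| z j + s * i.
  have := zP i lt_i; rewrite /dvdn => /eqP <-.
  by rewrite eq_sym eqn_modDr E.
have : n %| s * j - s * i by rewrite -(subnDl (z j)) dvdn_sub // zP.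
rewrite -mulnBr Gauss_dvdr ?coprime_ns // => /dvdn_leq.
by case: (posnP (j - i)) => [|_ /(_ isT)]; lia.
Qed.

Section Word.
Variable w : bitseq.
Hypotheses (ww : w \in words n s) (nnw : nonneg_word w).

Lemma size_w : size w = n.
Proof. by move: ww; rewrite mem_words => /andP [/eqP]. Qed.

Lemma ones_w : ones w = s.
Proof. by move: ww; rewrite mem_words => /andP [_ /eqP]. Qed.

Lemma nheightE i : i <= n -> nheight w i + s * i = n * prefix_ones w i.
Proof.
rewrite leq_eqVlt => /orP [/eqP ->|lt_i].
  by rewrite /nheight /height -size_w prefix_ones_size ones_w mulnC; lia.
have /allP /(_ i) := nnw; rewrite mem_iota /= add0n size_w lt_i => /(_ isT).
by rewrite /nheight /height size_w ones_w; lia.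
Qed.

Lemma nheight0 : nheight w 0 = 0.
Proof. by have := nheightE (leq0n n); rewrite prefix_ones0; lia. Qed.

Lemma nheight_size : nheight w n = 0.
Proof.
have := nheightE (leqnn n); have := prefix_ones_size w.
by rewrite size_w ones_w => ->; lia.
Qed.

Lemma nheightS i : i < n ->
  nheight w i.+1 + (if nth false w i then 0 else s) =
  nheight w i + (if nth false w i then t else 0).
Proof.
move=> lt_i; have := nheightE (ltnW lt_i); have := nheightE lt_i.
by rewrite prefix_onesS ?size_w //; case: nth; rewrite ?addn1 ?addn0; lia.
Qed.

Lemma nheight_inj i j : i < n -> j < n ->
  nheight w i = nheight w j %[mod n] -> i = j.
Proof.
apply: mod_heights_inj => k lt_k.
by rewrite nheightE ?(ltnW lt_k) // dvdn_mulr.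
Qed.

(** Closes the cycle: the final height equals the initial one, so the successor of the last index
    can be replaced by [0]. *)
Lemma nheight_wrap i : i <= n -> exists2 j, j < n & nheight w j = nheight w i.
Proof.
rewrite leq_eqVlt => /orP [/eqP ->|lt_i]; last by exists i.
by exists 0; rewrite ?n_gt0 ?nheight0 ?nheight_size.
Qed.

Lemma mem_height_gaps h :
  h \in height_gaps w <->
  exists2 i, i < n & h < nheight w i /\ h = nheight w i %[mod n].
Proof.
rewrite /height_gaps size_w; split.
  case/allpairsPdep => i [j [iP jP ->]]; rewrite !mem_iota /= !add0n in iP jP.
  exists i => //; split; last by rewrite addnC mulnC modnMDl modn_mod.
  by rewrite [X in _ < X](divn_eq _ n) addnC ltn_add2r mulnC ltn_pmul2r ?n_gt0.
case=> i lt_i [lt_h hE]; apply/allpairsPdep.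
exists i, (h %/ n); rewrite !mem_iota /= !add0n lt_i; split=> //.
  rewrite -(ltn_pmul2r n_gt0); have := divn_eq h n; have := divn_eq (nheight w i) n.
  by rewrite hE; lia.
by rewrite -hE addnC mulnC -divn_eq.
Qed.

Lemma height_gaps_uniq : uniq (height_gaps w).
Proof.
rewrite /height_gaps size_w; apply: allpairs_uniq_dep; rewrite ?iota_uniq //.
  by move=> i _; apply: iota_uniq.
move=> [i j] [i' j'] /allpairsPdep [k [l [kP _ [-> ->]]]].
case/allpairsPdep => k' [l' [kP' _ [-> ->]]] /= E {i j i' j'}.
rewrite !mem_iota /= !add0n in kP kP'.
have kk : k = k'.
  apply: nheight_inj => //; move/(congr1 (modn^~ n)): E.
  by rewrite ![_ + n * _]addnC ![n * _]mulnC !modnMDl !modn_mod.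
rewrite -kk in E *; congr existT; move/eqP: E.
by rewrite eqn_add2l eqn_pmul2l ?n_gt0 // => /eqP.
Qed.

Lemma sorted_gaps : sorted gtn (sort geq (height_gaps w)).
Proof.
rewrite gtn_sorted_uniq_geq sort_uniq height_gaps_uniq /=.
by apply: sort_sorted => x y; apply: leq_total.
Qed.

Lemma zero_notin_gaps : 0 \notin sort geq (height_gaps w).
Proof.
rewrite mem_sort; apply/negP => /mem_height_gaps [i lt_i [gt0 E]].
have i0 : i = 0 by apply: nheight_inj; rewrite ?n_gt0 // nheight0.
by rewrite i0 nheight0 in gt0.
Qed.

Lemma beta_core_of : is_part (core_of w) /\
  beta (core_of w) = sort geq (height_gaps w).
Proof. exact: unbeta_spec sorted_gaps zero_notin_gaps. Qed.

(** A step changes the height by [- s] or by [t = n - s], so the next height is above [h - s] and in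
    its class modulo [n]. *)
Lemma gaps_sub_s h : h \in height_gaps w -> s <= h -> h - s \in height_gaps w.
Proof.
case/mem_height_gaps => i lt_i [lt_h hE] le_sh.
have [j lt_j jE] := nheight_wrap lt_i.
apply/mem_height_gaps; exists j => //; rewrite jE.
have := nheightS lt_i; case: nth => zE; split; try lia.
- apply/eqP; rewrite -(eqn_modDr s) subnK //.
  have -> : nheight w i.+1 + s = nheight w i + n by lia.
  by rewrite modnDr hE.
- by apply/eqP; rewrite -(eqn_modDr s) subnK // zE addn0 hE.
Qed.

(** Dually, one step back changes the height by [- t] or by [s = n - t]. The initial height is [0]
    and has no gap below it. *)
Lemma gaps_sub_t h : h \in height_gaps w -> t <= h -> h - t \in height_gaps w.
Proof.
case/mem_height_gaps => -[|i] lt_i [lt_h hE] le_th.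
  by rewrite nheight0 in lt_h.
apply/mem_height_gaps; exists i; first exact: ltnW.
have := nheightS (ltnW lt_i); case: nth => zE; split; try lia.
- by apply/eqP; rewrite -(eqn_modDr t) subnK // -zE addn0 hE.
- apply/eqP; rewrite -(eqn_modDr t) subnK //.
  have -> : nheight w i + t = nheight w i.+1 + n by lia.
  by rewrite modnDr hE.
Qed.

Lemma core_of_st_core : st_cores s t (core_of w).
Proof.
have [pla bE] := beta_core_of; split=> //.
- apply/is_coreP => // h; rewrite bE !mem_sort; exact: gaps_sub_s.
- apply/is_coreP => // h; rewrite bE !mem_sort; exact: gaps_sub_t.
Qed.

Lemma nheight_notin_gaps i : i <= n -> nheight w i \notin height_gaps w.
Proof.
move=> /nheight_wrap [j lt_j <-]; apply/negP => /mem_height_gaps [k lt_k [lt_jk E]].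
by have jk := nheight_inj lt_j lt_k E; rewrite jk ltnn in lt_jk.
Qed.

(** The gaps determine the letters: after a step up, [z - s], if natural, is [n] below the next
    height and so a gap; after a step down it is the next height, and heights are never gaps. *)
Lemma gaps_step i : i < n ->
  nth false w i = ~~ ((s <= nheight w i) && (nheight w i - s \notin height_gaps w)).
Proof.
move=> lt_i; have := nheightS lt_i; case: nth => zE; apply/esym.
  apply/negP => /andP [le_s /negP]; apply.
  have [j lt_j jE] := nheight_wrap lt_i.
  apply/mem_height_gaps; exists j => //; rewrite jE; split; first lia.
  have -> : nheight w i.+1 = nheight w i - s + n by lia.
  by rewrite modnDr.
apply/negbTE; rewrite negbK; apply/andP; split; first lia.
have -> : nheight w i - s = nheight w i.+1 by lia.
exact: nheight_notin_gaps.
Qed.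

End Word.

Definition steps_down (B : seq nat) (z : nat) : bool :=
  (s <= z) && (z - s \notin B).

Fixpoint walk (B : seq nat) (i : nat) : nat :=
  if i is i'.+1 then
    let z := walk B i' in if steps_down B z then z - s else z + t
  else 0.

Definition word_of (B : seq nat) : bitseq :=
  mkseq (fun i => ~~ steps_down B (walk B i)) n.

Lemma word_of_core w : w \in words n s -> nonneg_word w ->
  word_of (beta (core_of w)) = w.
Proof.
move=> ww nnw; have [_ bE] := beta_core_of ww nnw.
have downE z : steps_down (beta (core_of w)) z =
    (s <= z) && (z - s \notin height_gaps w).
  by rewrite /steps_down bE mem_sort.
have walkE i : i <= n -> walk (beta (core_of w)) i = nheight w i.
  elim: i => [|i IH] lt_i; first by rewrite (nheight0 ww nnw).
  rewrite /= IH ?(ltnW lt_i) // downE.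
  have := nheightS ww nnw lt_i; rewrite (gaps_step ww nnw lt_i).
  by case: andP => [[le_s _]|_] /=; lia.
apply: (@eq_from_nth _ false); first by rewrite size_mkseq (size_w ww).
move=> i; rewrite size_mkseq => lt_i; rewrite nth_mkseq // walkE ?(ltnW lt_i) //.
by rewrite downE -(gaps_step ww nnw lt_i).
Qed.

Section Core.
Variable la : seq nat.
Hypothesis core_la : st_cores s t la.
Local Notation B := (beta la).

Lemma la_part : is_part la. Proof. by case: core_la. Qed.

Lemma beta_sub_s h : h \in B -> s <= h -> h - s \in B.
Proof. by case: core_la => p /(is_coreP s0 p) + _; apply. Qed.

Lemma beta_sub_t h : h \in B -> t <= h -> h - t \in B.
Proof. by case: core_la => p _ /(is_coreP t0 p); apply. Qed.

Lemma beta_sub_mul h k : h + n * k \in B -> h \in B.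
Proof.
elim: k => [|k IH]; first by rewrite muln0 addn0.
move=> /beta_sub_s H; apply: IH.
have /beta_sub_t : h + n * k.+1 - s \in B by apply: H; rewrite mulnS; lia.
have -> : h + n * k.+1 - s - t = h + n * k by rewrite mulnS; lia.
by apply; rewrite mulnS; lia.
Qed.

(** The invariant of the walk: it stays on the least elements outside [B] of their classes modulo
    [n]. A step up happens when [z - s], which is [z + t - n], is negative or in [B]. *)
Lemma walk_generator i :
  walk B i \notin B /\ (n <= walk B i -> walk B i - n \in B).
Proof.
elim: i => [|i [zB zn]] /=; first by split; [apply: beta_gt0 la_part | lia].
case: ifP => [/andP [le_s zsB]|/negbT]; first split=> // le_n.
  have /beta_sub_s : walk B i - n \in B by apply: zn; lia.
  have -> : walk B i - n - s = walk B i - s - n by lia.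
  by apply; lia.
rewrite /steps_down negb_and -ltnNge negbK => dn; split.
  apply/negP => /beta_sub_t; rewrite addnK => /(_ (leq_addl _ _)).
  by rewrite (negbTE zB).
move=> le_n; case/orP: dn => [lt_s|]; first by lia.
by have -> : walk B i + t - n = walk B i - s by lia.
Qed.

Lemma walk_prefix i : i <= n ->
  walk B i + s * i = n * prefix_ones (word_of B) i.
Proof.
elim: i => [|i IH] lt_i; first by rewrite prefix_ones0 !muln0.
rewrite prefix_onesS ?size_mkseq // nth_mkseq // mulnDr -IH ?(ltnW lt_i) //=.
by case: ifP => [/andP [le_s _]|_] /=; rewrite mulnS; lia.
Qed.

(** After [n] steps the walk is at a multiple of [n]. A positive one would put a smaller multiple
    into [B] by the invariant, and then [0] as well. *)
Lemma walk_size : walk B n = 0.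
Proof.
have [zB zn] := walk_generator n; apply/eqP; rewrite -leqn0 leqNgt.
apply/negP => z0; have := walk_prefix (leqnn n) => /(congr1 (dvdn n)).
rewrite dvdn_mulr // dvdn_addl ?dvdn_mull // => /dvdnP [k kE].
have k0 : 0 < k by case: k kE => [|//]; lia.
have := zn; rewrite kE leq_pmull // => /(_ isT).
have -> : k * n - n = 0 + n * k.-1 by case: k k0 {kE} => // k _; rewrite mulSn mulnC; lia.
by move/beta_sub_mul; rewrite (negbTE (beta_gt0 la_part)).
Qed.

Lemma word_of_words : word_of B \in words n s.
Proof.
have sz : size (word_of B) = n by rewrite size_mkseq.
rewrite mem_words sz eqxx /= -prefix_ones_size sz.
have := walk_prefix (leqnn n); rewrite walk_size add0n mulnC => /eqP.
by rewrite eqn_pmul2l ?n_gt0 // eq_sym.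
Qed.

Lemma height_word_of i : i <= n -> height (word_of B) i = (walk B i)%:Z.
Proof.
move=> le_i; rewrite /height (size_w word_of_words) (ones_w word_of_words).
by have := walk_prefix le_i; lia.
Qed.

Lemma nonneg_word_of : nonneg_word (word_of B).
Proof.
apply/allP => i; rewrite mem_iota /= add0n (size_w word_of_words) => lt_i.
by rewrite height_word_of // ltnW.
Qed.

(** The heights meet every class modulo [n] once, and [B] is closed under subtracting [n], so by the
    invariant [B] contains exactly the elements of a class that lie below its height. *)
Lemma mem_word_of_gaps : height_gaps (word_of B) =i B.
Proof.
have zE i : i < n -> nheight (word_of B) i = walk B i.
  by move=> lt_i; rewrite /nheight height_word_of // ltnW.
move=> h; apply/idP/idP.
  case/(mem_height_gaps word_of_words nonneg_word_of) => i lt_i.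
  rewrite zE // => -[lt_h hE]; have [_ zn] := walk_generator i.
  have : n %| walk B i - h by rewrite -eqn_mod_dvd 1?ltnW // hE.
  case/dvdnP => k kE; have k0 : 0 < k by case: k kE => //; lia.
  have zhE : walk B i = h + n * k.-1 + n.
    by case: k k0 kE => // k _; rewrite mulSn mulnC /=; lia.
  by apply: (@beta_sub_mul h k.-1); have := zn; rewrite zhE addnK; apply; apply: leq_addl.
move=> hB.
have [i lt_i iE] := residue_index h n_gt0
  (@nheight_inj _ word_of_words nonneg_word_of).
apply/(mem_height_gaps word_of_words nonneg_word_of); exists i => //.
split=> //; rewrite ltnNge; apply/negP => le_h; rewrite zE // in iE le_h.
have : n %| h - walk B i by rewrite -eqn_mod_dvd // iE.
case/dvdnP => k kE; have [/negP zB _] := walk_generator i; apply: zB.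
by apply: (@beta_sub_mul _ k); rewrite mulnC -kE subnKC.
Qed.

Lemma core_of_word_of : core_of (word_of B) = la.
Proof.
rewrite -[RHS]unbeta_beta /core_of; congr unbeta.
apply: (@irr_sorted_eq _ gtn); rewrite ?sorted_gaps ?word_of_words ?nonneg_word_of //.
- by move=> x y z /= yx zy; apply: ltn_trans zy yx.
- by move=> x /=; rewrite ltnn.
- exact: beta_sorted la_part.
- by move=> h; rewrite mem_sort mem_word_of_gaps.
Qed.

End Core.

Definition nonneg_words : seq bitseq := [seq w <- words n s | nonneg_word w].

Lemma core_of_perm :
  uniq [seq core_of w | w <- nonneg_words] /\
  forall la, st_cores s t la <-> la \in [seq core_of w | w <- nonneg_words].
Proof.
split.
  rewrite map_inj_in_uniq ?filter_uniq ?words_uniq // => v w.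
  rewrite !mem_filter => /andP [nv wv] /andP [nw ww] E.
  by rewrite -(word_of_core wv nv) E word_of_core.
move=> la; split=> [cla|/mapP [w]].
  apply/mapP; exists (word_of (beta la)); last by rewrite core_of_word_of.
  by rewrite mem_filter nonneg_word_of // word_of_words.
by rewrite mem_filter => /andP [nw ww] ->; apply: core_of_st_core.
Qed.

End Heights.

(** * The size of a core as a rotation-invariant statistic *)

Lemma sum_iotaS (R : nmodType) (F : nat -> R) n :
  \sum_(i <- iota 0 n.+1) F i = \sum_(i <- iota 0 n) F i + F n.
Proof. by rewrite -addn1 iotaD big_cat big_seq1. Qed.

Lemma sum_iota_affine (a b : rat) n :
  \sum_(i <- iota 0 n) (a + b * i%:R) =
    n%:R * a + b * (n%:R * (n%:R - 1)) / 2%:R.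
Proof.
elim: n => [|n IH]; first by rewrite big_nil !mul0r mulr0 mul0r addr0.
by rewrite sum_iotaS IH -natr1; field.
Qed.

Lemma sum_iota_id n :
  \sum_(i <- iota 0 n) (i%:R : rat) = n%:R * (n%:R - 1) / 2%:R.
Proof.
rewrite -[RHS]mul1r -[LHS]mul1r mulr_sumr; have := sum_iota_affine 0 1 n.
by rewrite mulr0 add0r mulrA => <-; apply: eq_bigr => i _; rewrite add0r.
Qed.

Lemma sum_iota_sqr n : \sum_(i <- iota 0 n) ((i%:R : rat) ^+ 2) =
  n%:R * (n%:R - 1) * (2%:R * n%:R - 1) / 6%:R.
Proof.
elim: n => [|n IH]; first by rewrite big_nil !mul0r.
by rewrite sum_iotaS IH -natr1; field.
Qed.

Lemma bin2_rat n : ('C(n, 2)%:R : rat) = n%:R * (n%:R - 1) / 2%:R.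
Proof.
elim: n => [|n IH]; first by rewrite !mul0r.
by rewrite binS bin1 natrD IH -natr1; field.
Qed.

Definition height_sum (g : rat -> rat) (w : bitseq) : rat :=
  \sum_(i <- iota 0 (size w)) g (height w i)%:~R.

Lemma path_sumE u w : path_sum u w =
  \sum_(i <- iota 0 (size w)) u (prefix_ones w i) (i - prefix_ones w i)%N.
Proof.
rewrite /path_sum -(big_mkord xpredT
  (fun i => u (prefix_ones w i) (i - prefix_ones w i)%N)).
by rewrite /index_iota subn0.
Qed.

Lemma size_statE w : (0 < size w)%N ->
  size_stat w = ((size w)%:R * height_sum (fun h => h ^+ 2) w
    - height_sum id w ^+ 2) / (2%:R * (size w)%:R ^+ 2)
    - ((size w)%:R ^+ 2 - 1) / 24%:R.
Proof.
move=> sz; set n : rat := (size w)%:R; have n0 : n != 0 by rewrite pnatr_eq0 -lt0n.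
have nE : (ones w)%:R + (zeros w)%:R = n.
  by rewrite -natrD /zeros subnKC // ones_le.
pose s : rat := (ones w)%:R.
pose U : rat := \sum_(i <- iota 0 (size w)) (prefix_ones w i)%:R.
pose V : rat := \sum_(i <- iota 0 (size w)) (prefix_ones w i)%:R ^+ 2.
pose W : rat := \sum_(i <- iota 0 (size w)) (prefix_ones w i)%:R * i%:R.
have hE i : (height w i)%:~R = n * (prefix_ones w i)%:R - s * i%:R :> rat.
  by rewrite /height intrB -!pmulrn !natrM.
have S1 : height_sum id w = n * U - s * (n * (n - 1) / 2%:R).
  rewrite -sum_iota_id /height_sum /U !mulr_sumr -sumrB.
  by apply: eq_bigr => i _; rewrite hE.
have S2 : height_sum (fun h => h ^+ 2) w = n ^+ 2 * V - 2%:R * n * s * W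
    + s ^+ 2 * (n * (n - 1) * (2%:R * n - 1) / 6%:R).
  rewrite -sum_iota_sqr /height_sum /V /W !mulr_sumr -sumrB -big_split.
  by apply: eq_bigr => i _; rewrite hE /=; ring.
have WE : path_sum (fun x y => x%:R * (x + y)%:R) w = W.
  rewrite path_sumE; apply: eq_big_seq => i; rewrite mem_iota /= add0n => lt_i.
  rewrite subnKC // /prefix_ones (leq_trans (ones_le _)) // size_take.
  by case: ifP => //; rewrite lt_i.
rewrite /size_stat nE -/s WE !path_sumE -/U -/V S1 S2.
by field.
Qed.

(** Rotation moves the origin to index [k]. Heights are periodic because the height of the whole
    word is zero, which settles the case where [k + i] wraps around. *)
Lemma height_rot w k i : (k < size w)%N -> (i < size w)%N ->
  height (rot k w) i = height w ((k + i) %% size w) - height w k.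
Proof.
move=> lt_k lt_i; rewrite /height size_rot.
have -> : ones (rot k w) = ones w by rewrite /ones; apply/permP; rewrite perm_rot.
have onesD v1 v2 : ones (v1 ++ v2) = (ones v1 + ones v2)%N by apply: count_cat.
have wE : (prefix_ones w k + ones (drop k w) = ones w)%N.
  by rewrite /prefix_ones -onesD cat_take_drop.
have szd : size (drop k w) = (size w - k)%N by rewrite size_drop.
have [le_i|gt_i] := leqP i (size w - k).
  have E : (prefix_ones w (k + i) = prefix_ones w k + prefix_ones (rot k w) i)%N.
    rewrite /prefix_ones takeD onesD /rot takel_cat ?szd //.
  have [kiE|ki] := eqVneq (k + i)%N (size w).
    rewrite kiE modnn prefix_ones0; rewrite kiE prefix_ones_size in E.
    rewrite E !PoszM PoszD; have -> : i%:Z = (size w)%:Z - k%:Z by lia.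
    by ring.
  rewrite modn_small; last by lia.
  by rewrite E !PoszM !PoszD; ring.
have -> : ((k + i) %% size w = k + i - size w)%N.
  by rewrite -{1}(subnK (_ : size w <= k + i)%N) ?modnDr ?modn_small //; lia.
have -> : prefix_ones (rot k w) i = (ones (drop k w) + prefix_ones w (k + i - size w))%N.
  rewrite /prefix_ones /rot take_cat szd ltnNge (ltnW gt_i) /= onesD take_takel; last by lia.
  by congr (_ + ones (take _ _))%N; lia.
rewrite -wE !PoszM !PoszD.
have -> : (k + i - size w)%:Z = k%:Z + i%:Z - (size w)%:Z by lia.
by ring.
Qed.

Lemma height_sum_rot g w k : (k < size w)%N ->
  height_sum g (rot k w) = height_sum (fun h => g (h - (height w k)%:~R)) w.
Proof.
move=> lt_k; have sz : (0 < size w)%N by apply: leq_ltn_trans lt_k.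
rewrite /height_sum size_rot.
have pm : perm_eq [seq (k + i) %% size w | i <- iota 0 (size w)]%N (iota 0 (size w)).
  apply: residues_perm => // i j lt_i lt_j /eqP; rewrite eqn_modDl => /eqP.
  by rewrite !modn_small.
rewrite -[RHS](perm_big _ pm) /=.
rewrite big_map; apply: eq_big_seq => i; rewrite mem_iota /= add0n => lt_i.
by rewrite height_rot // intrB.
Qed.

(** By [height_sum_rot] a rotation only translates the heights, up to order, and a variance does not
    change under translation. *)
Lemma size_stat_rot w k : (k < size w)%N -> size_stat (rot k w) = size_stat w.
Proof.
move=> lt_k; have sz : (0 < size w)%N by apply: leq_ltn_trans lt_k.
rewrite !size_statE ?size_rot // !height_sum_rot //.
set c : rat := (height w k)%:~R; set n : rat := (size w)%:R.
have cst a : \sum_(i <- iota 0 (size w)) a = n * a.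
  by rewrite big_const_seq count_predT size_iota iter_addr addr0 mulr_natl.
have -> : height_sum (fun h => id (h - c)) w = height_sum id w - n * c.
  by rewrite /height_sum sumrB cst.
have -> : height_sum (fun h => (h - c) ^+ 2) w =
    height_sum (fun h => h ^+ 2) w - 2%:R * c * height_sum id w + n * c ^+ 2.
  rewrite /height_sum mulr_sumr -sumrB -cst -big_split.
  by apply: eq_bigr => i _ /=; ring.
congr (_ / _ - _); ring.
Qed.

(** * The cycle lemma and expectations over cores *)

Section CycleLemma.
Variables s t : nat.
Hypotheses (s0 : (0 < s)%N) (t0 : (0 < t)%N) (cop_st : coprime s t).
Local Notation n := (s + t)%N.

(** Write each height as [n q + r]; the remainders run over [0, ..., n - 1]. The gaps below it are
    [r + n j] with [j < q], so the number and the sum of the beta-numbers are sums in [q] and [r],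
    and [sumn_beta] turns them into the size. *)
Lemma sumn_core_of w : w \in words n s -> nonneg_word w ->
  (sumn (core_of w))%:R = size_stat w.
Proof.
move=> ww nnw; have sz := size_w ww.
have n0 : (n%:R : rat) != 0 by rewrite pnatr_eq0 -lt0n addn_gt0 s0.
rewrite size_statE sz ?addn_gt0 ?s0 //.
pose q i := (nheight w i %/ n)%N; pose r i := (nheight w i %% n)%N.
pose Q1 : rat := \sum_(i <- iota 0 n) (q i)%:R.
pose Q2 : rat := \sum_(i <- iota 0 n) (q i)%:R ^+ 2.
pose QR : rat := \sum_(i <- iota 0 n) (q i)%:R * (r i)%:R.
have hE i : i \in iota 0 n -> (height w i)%:~R = n%:R * (q i)%:R + (r i)%:R :> rat.
  rewrite mem_iota /= add0n => lt_i; have /allP /(_ i) := nnw.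
  rewrite sz mem_iota /= add0n lt_i => /(_ isT) h0.
  have -> : height w i = (nheight w i)%:Z by rewrite /nheight; lia.
  rewrite -pmulrn; have /(congr1 (fun k => k%:R : rat)) := divn_eq (nheight w i) n.
  by rewrite -/(q i) -/(r i) natrD natrM => ->; rewrite mulrC.
have rP : perm_eq [seq r i | i <- iota 0 n] (iota 0 n).
  by apply: residues_perm; [rewrite addn_gt0 s0 | apply: nheight_inj].
have R1 : \sum_(i <- iota 0 n) (r i)%:R = n%:R * (n%:R - 1) / 2%:R :> rat.
  by rewrite -sum_iota_id -[RHS](perm_big _ rP) big_map.
have R2 : \sum_(i <- iota 0 n) (r i)%:R ^+ 2 =
    n%:R * (n%:R - 1) * (2%:R * n%:R - 1) / 6%:R :> rat.
  by rewrite -sum_iota_sqr -[RHS](perm_big _ rP) big_map.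
have S1 : height_sum id w = n%:R * Q1 + n%:R * (n%:R - 1) / 2%:R.
  rewrite /height_sum sz -R1 /Q1 mulr_sumr -big_split.
  by apply: eq_big_seq => i /hE.
have S2 : height_sum (fun h => h ^+ 2) w = n%:R ^+ 2 * Q2 + 2%:R * n%:R * QR
    + n%:R * (n%:R - 1) * (2%:R * n%:R - 1) / 6%:R.
  rewrite /height_sum sz -R2 /Q2 /QR !mulr_sumr -!big_split.
  by apply: eq_big_seq => i /hE /= ->; ring.
have [_ bE] := beta_core_of s0 t0 cop_st ww nnw.
have gE : perm_eq (beta (core_of w)) (height_gaps w) by rewrite bE perm_sort.
have kE : (size (core_of w))%:R = Q1.
  rewrite -size_beta (perm_size gE) /height_gaps size_allpairs_dep sz.
  rewrite sumnE big_map natr_sum; apply: eq_bigr => i _.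
  by rewrite size_iota.
have sE : (sumn (beta (core_of w)))%:R = QR + n%:R * (Q2 - Q1) / 2%:R.
  rewrite (perm_sumn gE) sumnE natr_sum /height_gaps big_allpairs_dep sz /=.
  rewrite /QR /Q2 /Q1 -sumrB mulr_sumr mulr_suml -big_split.
  apply: eq_bigr => i _ /=; rewrite -/(q i) -/(r i).
  under eq_bigr => j _ do rewrite natrD natrM.
  by rewrite sum_iota_affine; field.
have -> : (sumn (core_of w))%:R = QR + n%:R * (Q2 - Q1) / 2%:R
    - Q1 * (Q1 - 1) / 2%:R.
  by rewrite -sE sumn_beta natrD bin2_rat kE addrK.
by rewrite S1 S2; move: (n%:R : rat) n0 => N N0; field.
Qed.

Lemma height_inj w i j : w \in words n s -> (i < n)%N -> (j < n)%N ->
  height w i = height w j -> i = j.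
Proof.
move=> ww; wlog le_ij : i j / (i <= j)%N.
  move=> main lt_i lt_j E; case: (leqP i j) => le_ij; first exact: main.
  by apply/esym/main => //; apply: ltnW.
move=> lt_i lt_j; rewrite /height (size_w ww) (ones_w ww) => E.
have dv : (n %| s * (j - i))%N.
  have -> : (s * (j - i) = n * prefix_ones w j - n * prefix_ones w i)%N.
    by rewrite mulnBr; lia.
  by rewrite -mulnBr dvdn_mulr.
rewrite Gauss_dvdr ?coprime_ns // in dv; have := dvdn_leq _ dv.
by case: (posnP (j - i)) => [|p /(_ isT)]; lia.
Qed.

Lemma mem_words_rot k w : (rot k w \in words n s) = (w \in words n s).
Proof.
rewrite !mem_words size_rot; congr (_ && (_ == _)).
by rewrite /ones; apply/permP; rewrite perm_rot.
Qed.

(** The height at [k] is nonnegative in [w], and nonpositive because the rotated word passes the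
    origin of [w]. So it equals the height at [0], and heights are distinct. *)
Lemma nonneg_rot_eq0 w k : w \in words n s -> (k < n)%N ->
  nonneg_word w -> nonneg_word (rot k w) -> k = 0%N.
Proof.
move=> ww lt_k nnw nnr; case: k lt_k nnr => // k lt_k nnr.
have n0 : (0 < n)%N by rewrite addn_gt0 s0.
have h0 : height w 0 = 0 by rewrite /height prefix_ones0 !muln0.
have lt_nk : (n - k.+1 < n)%N by rewrite ltn_subrL n0.
have := allP nnr (n - k.+1)%N.
rewrite size_rot (size_w ww) mem_iota /= add0n lt_nk => /(_ isT).
rewrite height_rot ?(size_w ww) // subnKC ?(ltnW lt_k) // modnn h0 => le0.
have := allP nnw k.+1; rewrite (size_w ww) mem_iota /= add0n lt_k => /(_ isT) ge0.
by apply: (height_inj ww lt_k n0); rewrite h0; lia.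
Qed.

Lemma nonneg_rot_exists w : w \in words n s ->
  exists2 k, (k < n)%N & nonneg_word (rot k w).
Proof.
move=> ww; have n0 : (0 < n)%N by rewrite addn_gt0 s0.
(* Rotating to start at a lowest point makes all heights nonnegative. *)
case: (arg_minP (P := xpredT) (fun i : 'I_n => height w i) (i0 := Ordinal n0)) => // k _ kmin.
exists k => //; apply/allP => i; rewrite size_rot (size_w ww) mem_iota /= add0n => lt_i.
rewrite height_rot (size_w ww) // subr_ge0.
exact: (kmin (Ordinal (ltn_pmod (k + i) n0))).
Qed.

(* Cycle lemma: the heights of a word are distinct, so exactly one of its
   rotations is nonnegative. *)
Lemma words_rot_perm : perm_eq (words n s)
  [seq rot k w | w <- nonneg_words s t, k <- iota 0 n].
Proof.
apply: uniq_perm; first exact: words_uniq.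
  apply: allpairs_uniq; rewrite ?filter_uniq ?words_uniq ?iota_uniq //.
  move=> _ _ /allpairsP [[w k] [/= wP kP ->]] /allpairsP [[v l] [/= vP lP ->]] /= E.
  rewrite !mem_iota /= !add0n !mem_filter in wP kP vP lP.
  case/andP: wP => nw ww; case/andP: vP => nv wv.
  wlog le_kl : w v k l nw ww nv wv kP lP E / (k <= l)%N.
    move=> main; case: (leqP k l) => le_kl; first exact: (main w v).
    by apply/esym/(main v w) => //; apply: ltnW.
  have wE : w = rot (l - k) v.
    apply: (@rot_inj k); rewrite E -rotD ?subnKC // (size_w wv).
    exact: ltnW.
  have lk : (l - k)%N = 0%N.
    by apply: (nonneg_rot_eq0 wv) => //; [lia | rewrite -wE].
  by rewrite wE lk rot0; congr (_, _); lia.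
move=> w; apply/idP/allpairsP => [ww|[[v k] [/= vP kP ->]]]; last first.
  by rewrite mem_words_rot; move: vP; rewrite mem_filter => /andP [].
have [k lt_k nn] := nonneg_rot_exists ww.
have rw : rot k w \in nonneg_words s t by rewrite mem_filter nn mem_words_rot.
(* The inverse of rotation by [k] is rotation by [n - k], which leaves the index range when
   [k = 0]. *)
case: k lt_k nn rw => [|k] lt_k nn rw.
  rewrite rot0 in rw; exists (w, 0%N); rewrite /= rot0; split=> //.
  by rewrite mem_iota add0n addn_gt0 s0.
exists (rot k.+1 w, (n - k.+1)%N); rewrite /= rw mem_iota /= add0n; split=> //.
  by lia.
by rewrite -(size_w ww) -[in LHS](rotK k.+1 w) /rotr size_rot.
Qed.

(** Each core comes from one nonnegative word, whose [n] rotations share its statistic. The function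
    [f] is general so that counting and all moments are instances. *)
Lemma sum_words_cores (f : rat -> rat) :
  \sum_(w <- words n s) f (size_stat w) =
  n%:R * \sum_(la <- fset_set (st_cores s t)) f (part_size la).
Proof.
have [uc cP] := core_of_perm s0 t0 cop_st.
have fin : finite_set (st_cores s t).
  rewrite (_ : st_cores s t = [set` [seq core_of w | w <- nonneg_words s t]]%classic).
    exact: finite_seq.
  by apply/seteqP; split=> la /cP.
have cE : perm_eq (fset_set (st_cores s t)) [seq core_of w | w <- nonneg_words s t].
  apply: uniq_perm => // la; rewrite in_fset_set //.
  by apply/idP/idP => [/set_mem /cP | /cP /mem_set].
rewrite (perm_big _ cE) big_map (perm_big _ words_rot_perm) big_allpairs_dep mulr_sumr /=.
apply: eq_big_seq => w; rewrite mem_filter => /andP [nnw ww].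
rewrite (eq_big_seq (fun _ => f (part_size (core_of w)))).
  by rewrite big_const_seq count_predT size_iota iter_addr addr0 mulr_natl.
move=> k; rewrite mem_iota /= add0n => lt_k.
by rewrite size_stat_rot ?(size_w ww) // /part_size sumn_core_of.
Qed.

Lemma unif_expect_cores (f : rat -> rat) :
  unif_expect (st_cores s t) (fun la => f (part_size la)) =
  (\sum_(w <- words n s) f (size_stat w)) / 'C(n, s)%:R.
Proof.
have n0 : (n%:R : rat) != 0 by rewrite pnatr_eq0 -lt0n addn_gt0 s0.
(* The constant function [1] counts the cores, giving the rational Catalan number ['C(n, s) / n]. *)
have cardE : 'C(n, s)%:R = n%:R * (#|` fset_set (st_cores s t)|)%:R :> rat.
  have := sum_words_cores (fun _ => 1).
  by rewrite !big_const_seq !count_predT !iter_addr !addr0 size_words.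
by rewrite sum_words_cores cardE /unif_expect -mulf_div divff // mul1r.
Qed.

End CycleLemma.

(** * The mean and the sixth central moment of the size *)

Lemma sum_centred (s t : nat) (g : rat -> rat) :
  \sum_(w <- words (s + t) s) g (size_stat w - mean_poly s t) =
  wsum (fun w => g (centred_stat w)) s t.
Proof.
by apply: eq_big_seq => w /words_zeros [ws wt]; rewrite /centred_stat ws wt.
Qed.

Lemma bin_rat_neq0 (s t : nat) : ('C(s + t, s)%:R : rat) != 0.
Proof. by rewrite pnatr_eq0 -lt0n bin_gt0 leq_addr. Qed.

Lemma mean_cores (s t : nat) : (0 < s)%N -> (0 < t)%N -> coprime s t ->
  unif_expect (st_cores s t) part_size = mean_poly s t.
Proof.
move=> s0 t0 cop_st; apply/eqP; rewrite -subr_eq0; apply/eqP.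
have binN0 := bin_rat_neq0 s t.
rewrite (unif_expect_cores s0 t0 cop_st id).
apply: (mulIf binN0); rewrite mul0r mulrBl divfK //.
rewrite -[RHS](words_moments s t).1 -(sum_centred s t id) sumrB.
by rewrite big_const_seq count_predT iter_addr addr0 size_words mulr_natr.
Qed.

Lemma sixth_moment_cores (s t : nat) : (0 < s)%N -> (0 < t)%N -> coprime s t ->
  central_moment (st_cores s t) 6 part_size = sixth_poly s t.
Proof.
move=> s0 t0 cop_st; have binN0 := bin_rat_neq0 s t.
have [_] := words_moments s t; move: (sixth_poly s t) => P sixth.
rewrite /central_moment mean_cores //.
rewrite (unif_expect_cores s0 t0 cop_st (fun x => (x - mean_poly s t) ^+ 6)).
by rewrite (sum_centred s t (fun x => x ^+ 6)) sixth mulrC mulKf.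
Qed.

Theorem theorem6 (s t : nat) (s_gt0 : (0 < s)%N) (t_gt0 : (0 < t)%N)
    (cop_st : coprime s t) :
  central_moment (st_cores s t) 6 part_size =
    1 / 4184557977600%:R * s%:R * t%:R * (t%:R - 1) * (s%:R - 1)
      * (s%:R + t%:R + 1) * (s%:R + t%:R) * P6 s%:R t%:R.
Proof. exact: sixth_moment_cores. Qed.
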